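(* Let $\mu\ge\pi/2$, let $c_0>-1$, and let $\nu=\pi/(2\mu)$. For $\ell,j\in\mathbb{Z}$, $\ell\ge 0$, let $$H_{\ell,j}(z_1,z_2)=E_{c_0+\nu\ell+i(j+1)/2}(z_1,z_2)\,z_2^j .$$ Then, for each fixed $j\in\mathbb{Z}$, the function $H_{0,j}$ belongs to the closure in $A^2(\mathcal{W}'_\mu)$ of $\operatorname{span}\{H_{\ell,j}: \ell=1,2,\dots\}$. In particular, the system $\{H_{\ell,j}\}_{\ell,j\in\mathbb{Z},\,\ell\ge 0}$ (however enumerated as a sequence) is not a Schauder basis of $A^2(\mathcal{W}'_\mu)$.
   Context: For $\mu>0$, the truncated worm domain is $$\mathcal{W}'_\mu=\big\{(z_1,z_2)\in\mathbb{C}^2:\ z_2\neq 0,\ \big|z_1-e^{i\log|z_2|^2}\big|^2<1,\ \big|\log|z_2|^2\big|<\mu\big\}.$$ $A^2(\mathcal{W}'_\mu)$ is the Bergman space of holomorphic functions on $\mathcal{W}'_\mu$ that are square integrable with respect to Lebesgue measure, with the $L^2$ inner product. For $\eta\in\mathbb{C}$, $E_\eta$ is the holomorphic function on $\mathcal{W}'_\mu$ given by $$E_\eta(z)=e^{\eta L(z)},\qquad L(z)=\log\big(z_1e^{-i\log|z_2|^2}\big)+i\log|z_2|^2,$$ where $\log$ of a complex number denotes the principal branch (on $\mathcal{W}'_\mu$ the number $z_1e^{-i\log|z_2|^2}$ lies in the disk $\{|\zeta-1|<1\}$). A sequence $\{v_n\}$ in a Banach space $V$ is a Schauder basis if for each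 $w\in V$ there is a unique scalar sequence $\{c_n\}$ such that $\sum_n c_nv_n$ converges to $w$ in norm. *)

(* Defs.v *)
From HB Require Import structures.
From mathcomp Require Import all_boot all_order all_algebra.
From mathcomp Require Import all_classical all_reals all_analysis.
From mathcomp Require Import complex.
Set Implicit Arguments.
Unset Strict Implicit.
Unset Printing Implicit Defensive.
Import Order.TTheory GRing.Theory Num.Theory.
Import numFieldNormedType.Exports.
Import Normc.

Local Open Scope classical_set_scope.
Local Open Scope ring_scope.
Local Open Scope complex_scope.

(* R[i]^o is the complex plane as a normed space over the complex numbers, so
   that [differentiable] below means complex differentiability. *)
Notation C1 R := ((R[i])^o).
Notation C2 R := ((R[i])^o * (R[i])^o)%type.

Section Complex_functions.
Context {R : realType}.

Definition cexp (z : R[i]) : R[i] :=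
  (expR (complex.Re z) * cos (complex.Im z))
    +i* (expR (complex.Re z) * sin (complex.Im z)).

(* Principal argument, in ]-pi, pi], for z != 0. *)
Definition carg (z : R[i]) : R :=
  if 0 <= complex.Im z then acos (complex.Re z / normc z)
  else - acos (complex.Re z / normc z).

Definition clog (z : R[i]) : R[i] := ln (normc z) +i* carg z.

End Complex_functions.

Section Schauder.
Context {K : numDomainType} {R : realType} {V : lmodType K}.

Definition linspan (S : set V) : set V :=
  [set x | exists (n : nat) (c : 'I_n -> K) (s : 'I_n -> V),
     (forall i, S (s i)) /\ x = \sum_(i < n) c i *: s i].

(* In the next two definitions the normed space is given as a subspace A of V
   with a norm N; N takes values in \bar R because it may be infinite outside
   of A. *)
Definition norm_closure (A : set V) (N : V -> \bar R) (S : set V) : set V :=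
  [set w | A w /\
     forall e : R, 0 < e -> exists g, [/\ A g, S g & (N (w - g)%R < e%:E)%E]].

Definition schauder_basis (A : set V) (N : V -> \bar R) (v : nat -> V) : Prop :=
  (forall n, A (v n)) /\
  (forall w, A w -> exists! c : nat -> K,
     (fun n : nat => N (w - \sum_(k < n) c k *: v k)) @ \oo --> 0%E).

End Schauder.

Section Worm.
Context {R : realType}.
Implicit Types (mu : R) (f : C2 R -> C1 R).

Definition worm_angle (z : C2 R) : R := ln (normc z.2 ^+ 2).

Definition truncated_worm mu : set (C2 R) :=
  [set z | [/\ z.2 != 0,
               normc (z.1 - cexp (0 +i* worm_angle z)) ^+ 2 < 1 &
               `|worm_angle z| < mu]].

Definition holomorphic_on (D : set (C2 R)) f : Prop :=
  forall z, D z -> differentiable f z.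

Local Notation mR := (measurableTypeR R).

(* ((x1, y1), (x2, y2)) |-> (x1 + i y1, x2 + i y2) *)
Definition to_C2 (p : (mR * mR) * (mR * mR)) : C2 R :=
  (p.1.1 +i* p.1.2, p.2.1 +i* p.2.2).

(* The library has no canonical sigma-finite instance for the product of two
   sigma-finite measures; lebesgue_measure2 needs one to be used as a factor of
   lebesgue_measure4. *)
Definition lebesgue_measure2 : set (mR * mR) -> \bar R :=
  (@lebesgue_measure R \x @lebesgue_measure R)%E.

HB.instance Definition _ := Measure.on lebesgue_measure2.

Lemma lebesgue_measure2_sigma_finite : sigma_finite setT lebesgue_measure2.
Proof.
have /sigma_finiteP[F [TF ndF Foo]] := sigma_finiteT (@lebesgue_measure R).
exists (fun n => F n `*` F n).
  rewrite -setXTT TF predeqE => -[x y]; split.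
    move=> [/= [n _ Fnx] [k _ Fky]]; exists (maxn n k) => //; split.
    - by move: x Fnx; exact/subsetPset/ndF/leq_maxl.
    - by move: y Fky; exact/subsetPset/ndF/leq_maxr.
  by move=> [n _ []/= ? ?]; split; exists n.
move=> k; have [? ?] := Foo k; split; first exact: measurableX.
by rewrite /lebesgue_measure2 product_measure1E// lte_mul_pinfty// ge0_fin_numE.
Qed.

HB.instance Definition _ := @Measure_isSigmaFinite.Build _ _ _
  lebesgue_measure2 lebesgue_measure2_sigma_finite.

Definition lebesgue_measure4 :
    {measure set ((mR * mR) * (mR * mR))%type -> \bar R} :=
  (lebesgue_measure2 \x lebesgue_measure2)%E.

Definition L2norm (D : set (C2 R)) f : \bar R :=
  ((\int[lebesgue_measure4]_(p in to_C2 @^-1` D)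
      (normc (f (to_C2 p)) ^+ 2)%:E) `^ 2^-1)%E.

(* Functions are total on C^2: an element of the Bergman space is represented
   by any of its extensions, and [L2norm] only sees its values on D. *)
Definition bergman (D : set (C2 R)) : set (C2 R -> C1 R) :=
  [set f | holomorphic_on D f /\ (L2norm D f < +oo)%E].

Definition worm_L (z : C2 R) : R[i] :=
  clog (z.1 * cexp (0 -i* worm_angle z)) + (0 +i* worm_angle z).

Definition worm_E (eta : R[i]) (z : C2 R) : R[i] := cexp (eta * worm_L z).

Definition worm_H (c0 nu : R) (l : nat) (j : int) : C2 R -> C1 R :=
  fun z => worm_E ((c0 + nu * l%:R) +i* ((j + 1)%:~R / 2)) z
           * (z.2 : R[i]) ^ j.

End Worm.

(* Main.v *)
(** Put u = exp (nu L).  Then H_{l,j} = u^l H_{0,j}, and nu <= 1 forces u to avoid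
    the negative half-line.

    Closure: it is enough to find polynomials Q with Q(0) = 1 for which Q(u) is
    uniformly bounded and tends to 0 pointwise, since H_{0,j} - Q(u) H_{0,j} lies
    in the span of the H_{l,j} with l >= 1 and dominated convergence applies.  The
    algebraic function 2 / (1 + sqrt (1 + 4 lam u)) has these properties as
    lam -> oo; it is the attracting fixed point of Q' = 1 - Q - lam u Q^2, and
    Euler's scheme with small steps started at Q = 1 approximates it by polynomials
    in u that take the value 1 at u = 0.

    No basis: the terms of a convergent expansion are bounded in norm, and the norm
    of H_{l,j} is at least a exp (- b l + t |j|) with t > 0.  Hence the expansion
    converges absolutely and locally uniformly where the argument of zeta and the
    modulus of z1 are small, so that the L^2 limit is also the pointwise limit.  At
    z = (r, exp (- i (ln r) / 2)) the phase of H_{l,j} does not depend on (l, j),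
    and the expansion becomes a power series in r^nu.  Therefore the function with
    exponent c0 + nu / 2 in place of c0 + nu l, which behaves like the square root
    of r^nu there, has no expansion at all. *)

Require Import Defs.
From mathcomp Require Import all_boot all_order all_algebra.
From mathcomp Require Import all_classical all_reals all_analysis.
From mathcomp Require Import measurable_realfun.
From mathcomp Require Import complex.
From mathcomp Require Import ring lra.
Set Implicit Arguments.
Unset Strict Implicit.
Unset Printing Implicit Defensive.
Import Order.TTheory GRing.Theory Num.Theory.
Import numFieldNormedType.Exports.
Local Open Scope classical_set_scope.
Local Open Scope ring_scope.

(** * Modulus, exponential and principal logarithm on the complex plane *)

Section Complex.
Import Normc.
Local Open Scope complex_scope.
Context {R : realType}.
Implicit Types (z w : R[i]) (x y : R).

Lemma normc_ge0 z : 0 <= normc z.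
Proof. by case: z => x y; rewrite sqrtr_ge0. Qed.

Lemma normc_norm z : `|z| = (normc z)%:C.
Proof. by case: z => x y; rewrite normc_def. Qed.

Lemma ler_normcD z w : normc (z + w) <= normc z + normc w.
Proof. exact: (@le_normcD R z w). Qed.

Lemma normc_opp z : normc (- z) = normc z.
Proof. by case: z => x y /=; rewrite !sqrrN. Qed.

Lemma normcBC z w : normc (z - w) = normc (w - z).
Proof. by rewrite -normc_opp opprB. Qed.

Lemma normc_eq0 z : (normc z == 0) = (z == 0).
Proof.
by apply/eqP/eqP => [/eq0_normc|->]; rewrite ?normc0.
Qed.

Lemma normc_gt0 z : (0 < normc z) = (z != 0).
Proof. by rewrite lt_def normc_ge0 andbT normc_eq0. Qed.

Lemma normcX z n : normc (z ^+ n) = normc z ^+ n.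
Proof.
elim: n => [|n IH]; first by rewrite !expr0 normc1.
by rewrite !exprS normcM IH.
Qed.

Lemma sqr_normcE z : normc z ^+ 2 = complex.Re z ^+ 2 + complex.Im z ^+ 2.
Proof. by case: z => x y; rewrite sqr_sqrtr// addr_ge0 ?sqr_ge0. Qed.

Lemma normc_real x : normc x%:C = `|x|.
Proof. by rewrite /= expr0n addr0 sqrtr_sqr. Qed.

Lemma Re_le_normc z : `|complex.Re z| <= normc z.
Proof.
rewrite -(@ler_pXn2r _ 2) ?nnegrE ?normc_ge0//.
by rewrite sqr_normcE real_normK ?num_real// lerDl sqr_ge0.
Qed.

Lemma Im_le_normc z : `|complex.Im z| <= normc z.
Proof.
rewrite -(@ler_pXn2r _ 2) ?nnegrE ?normc_ge0//.
by rewrite sqr_normcE real_normK ?num_real// lerDr sqr_ge0.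
Qed.

Lemma normc_le_ReIm z : normc z <= `|complex.Re z| + `|complex.Im z|.
Proof.
rewrite -(@ler_pXn2r _ 2) ?nnegrE ?normc_ge0 ?addr_ge0//.
rewrite sqr_normcE sqrrD !real_normK ?num_real//.
by rewrite -addrA lerD2l lerDr mulrn_wge0// mulr_ge0.
Qed.

Lemma normc_cexp z : normc (cexp z) = expR (complex.Re z).
Proof.
case: z => x y; rewrite /cexp /= !exprMn -mulrDr cos2Dsin2 mulr1.
by rewrite sqrtr_sqr ger0_norm// expR_ge0.
Qed.

Lemma cexpD z w : cexp (z + w) = cexp z * cexp w.
Proof.
case: z w => [a b] [c d]; rewrite /cexp /= expRD cosD sinD.
apply/eqP; rewrite eq_complex /=; apply/andP; split; apply/eqP; ring.
Qed.

Lemma cexp0 : cexp 0 = 1 :> R[i].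
Proof. by rewrite /cexp /= expR0 cos0 sin0 !mul1r. Qed.

Lemma cexp_neq0 z : cexp z != 0.
Proof. by rewrite -normc_gt0 normc_cexp expR_gt0. Qed.

Lemma cexpN z : cexp (- z) = (cexp z)^-1.
Proof.
apply: (mulfI (cexp_neq0 z)); rewrite mulfV ?cexp_neq0//.
by rewrite -cexpD subrr cexp0.
Qed.

Lemma cexpMn z n : cexp (z *+ n) = cexp z ^+ n.
Proof.
elim: n => [|n IH]; first by rewrite mulr0n expr0 cexp0.
by rewrite mulrS exprS cexpD IH.
Qed.

Lemma cexp_real x : cexp x%:C = (expR x)%:C.
Proof. by rewrite /cexp /= cos0 sin0 mulr1 mulr0. Qed.

(* On the right half-plane [carg] has no branch, hence is continuous. *)
Lemma carg_atan z : 0 < complex.Re z ->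
  carg z = atan (complex.Im z / complex.Re z).
Proof.
case: z => a b /= a0.
have n0 : 0 < Num.sqrt (a ^+ 2 + b ^+ 2).
  by rewrite sqrtr_gt0 ltr_pwDl ?sqr_ge0 ?exprn_gt0.
set n := Num.sqrt _ in n0 *.
have n2 : n ^+ 2 = a ^+ 2 + b ^+ 2 by rewrite sqr_sqrtr ?addr_ge0 ?sqr_ge0.
have an1 : a / n <= 1.
  rewrite ler_pdivrMr// mul1r -(@ler_pXn2r _ 2) ?nnegrE ?(ltW n0) ?(ltW a0)// n2.
  by rewrite lerDl sqr_ge0.
have an0 : 0 < a / n by rewrite divr_gt0.
have aI : a / n \in `[(-1), 1] by rewrite in_itv /= an1 andbT; lra.
have /andP[aI1 aI2] : -1 <= a / n <= 1 by move: aI; rewrite in_itv.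
have sE : sin (acos (a / n)) = `|b| / n.
  rewrite sin_acos ?aI1// -[RHS]ger0_norm ?divr_ge0 ?(ltW n0)//.
  rewrite -sqrtr_sqr; congr Num.sqrt.
  rewrite !exprMn real_normK ?num_real//.
  have -> : b ^+ 2 = n ^+ 2 - a ^+ 2 by rewrite n2; ring.
  by field; rewrite gt_eqF.
have tE : tan (acos (a / n)) = `|b| / a.
  by rewrite /tan sE acosK//; field; rewrite !gt_eqF.
(* The positive real part puts the arccosine in the first quadrant, where [atan] inverts [tan]; the
   sign of [b] is restored at the end. *)
have ac0 : 0 <= acos (a / n) by rewrite acos_ge0 ?aI1.
have acp : acos (a / n) < pi / 2.
  rewrite -ltr_cos ?in_itv/=; last 2 first.
  - by rewrite ac0 acos_lepi// aI1.
  - by rewrite divr_ge0 ?pi_ge0//= ler_pdivrMr// ler_peMr ?pi_ge0 ?ler1n.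
  by rewrite cos_pihalf acosK.
have pp := pi_gt0 R.
have atE : acos (a / n) = atan (`|b| / a).
  by rewrite -tE tanK// in_itv /= acp andbT; lra.
rewrite /carg /= -/n atE.
by case: ifP => [b0|/negbT]; [rewrite ger0_norm|rewrite -ltNge => b0;
  rewrite ltr0_norm// mulNr atanN opprK].
Qed.

Lemma carg_bound z : 0 < complex.Re z -> `|carg z| < pi / 2.
Proof.
by move=> z0; rewrite carg_atan// ltr_norml atan_gtNpi2 atan_ltpi2.
Qed.

Lemma normc_gt0_Re z : 0 < complex.Re z -> 0 < normc z.
Proof. by move=> z0; rewrite normc_gt0; apply: contraTneq z0 => ->; rewrite ltxx. Qed.

Lemma cos_carg z : 0 < complex.Re z -> cos (carg z) = complex.Re z / normc z.
Proof.
move=> z0; have n0 := normc_gt0_Re z0.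
have zI : complex.Re z / normc z \in `[(-1), 1].
  rewrite in_itv /= -ler_norml normrM normfV (gtr0_norm n0) ler_pdivrMr//.
  by rewrite mul1r Re_le_normc.
by rewrite /carg; case: ifP => _; rewrite ?cosN acosK.
Qed.

(** Deduced from the cosine and from the tangent supplied by [carg_atan], so that the two sign cases
    of [carg] need not be reopened. *)
Lemma sin_carg z : 0 < complex.Re z -> sin (carg z) = complex.Im z / normc z.
Proof.
move=> z0; have n0 := normc_gt0_Re z0.
have c0 : cos (carg z) != 0.
  by rewrite cos_carg// gt_eqF// divr_gt0.
have := carg_atan z0 => /(congr1 tan); rewrite atanK /tan => /(canRL (divfK c0)).
by move=> ->; rewrite cos_carg//; field; rewrite !gt_eqF.
Qed.

Lemma clogK z : 0 < complex.Re z -> cexp (clog z) = z.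
Proof.
move=> z0; have n0 := normc_gt0_Re z0.
rewrite /clog /cexp /= lnK ?posrE// cos_carg// sin_carg//.
by apply/eqP; rewrite eq_complex /=; apply/andP; split; apply/eqP; field;
  rewrite gt_eqF.
Qed.

End Complex.

(** * Neighbourhoods, limits and differentiability with real tolerances *)

Section Topology.
Import Normc.
Local Open Scope complex_scope.
Context {R : realType}.

(** The order on [R[i]] compares only numbers with equal imaginary parts, so a positive complex
    radius is a real one. All later estimates can therefore use real tolerances. *)
Lemma gt0_complexE (e : R[i]) : 0 < e -> e = (complex.Re e)%:C /\ 0 < complex.Re e.
Proof.
by case: e => x y; rewrite ltcE /= => /andP[/eqP -> x0].
Qed.

Lemma nbhs_C1P (z : C1 R) (A : set (C1 R)) : nbhs z A <->
  exists2 e : R, 0 < e & forall w, normc (w - z) < e -> A w.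
Proof.
split=> [/(@nbhs_ballP R[i] (C1 R))[e /= /gt0_complexE[-> e0]]|[e e0 H]].
  rewrite -ball_normE => H; exists (complex.Re e) => // w wz; apply: H => /=.
  by rewrite normc_norm ltcR normcBC.
apply/(@nbhs_ballP R[i] (C1 R)); exists e%:C => /=; first by rewrite ltcR.
by rewrite -ball_normE => w /=; rewrite normc_norm ltcR normcBC; exact: H.
Qed.

Lemma near0_C1P (A : set (C1 R)) : (\forall z \near (0 : C1 R), A z) <->
  exists2 e : R, 0 < e & forall w, normc w < e -> A w.
Proof.
split=> [/(nbhs_C1P (0 : C1 R) A)[e e0 H]|[e e0 H]].
  by exists e => // w we; apply: H; rewrite subr0.
by apply/(nbhs_C1P (0 : C1 R) A); exists e => // w; rewrite subr0; exact: H.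
Qed.

Lemma cvg_C1P (T : Type) (F : set_system T) {FF : Filter F} (f : T -> C1 R) (l : C1 R) :
  f @ F --> l <-> forall e : R, 0 < e -> \forall t \near F, normc (f t - l) < e.
Proof.
split=> [fl e e0|H].
  have : nbhs l [set w | normc (w - l) < e] by apply/nbhs_C1P; exists e.
  by move/fl.
move=> A /nbhs_C1P[e e0 eA]; have := H e e0.
by apply: filterS => t; exact: eA.
Qed.

Lemma cvg_R_of_normc (T : Type) (F : set_system T) {FF : Filter F} (f : T -> C1 R)
  (l : C1 R) (g : C1 R -> R) : (forall z w, `|g z - g w| <= normc (z - w)) ->
  f @ F --> l -> g (f t) @[t --> F] --> g l.
Proof.
move=> gl /cvg_C1P fl; apply/cvgrPdist_lt => e e0.
have := fl _ e0; apply: filterS => t; apply: le_lt_trans.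
by rewrite distrC.
Qed.

Lemma cvg_Re (T : Type) (F : set_system T) {FF : Filter F} (f : T -> C1 R) (l : C1 R) :
  f @ F --> l -> complex.Re (f t) @[t --> F] --> complex.Re l.
Proof.
apply: (@cvg_R_of_normc _ _ _ f l (@complex.Re R)) => z w.
by rewrite -[_ - _](raddfB (@complex.Re R : {additive R[i] -> R})) Re_le_normc.
Qed.

Lemma cvg_Im (T : Type) (F : set_system T) {FF : Filter F} (f : T -> C1 R) (l : C1 R) :
  f @ F --> l -> complex.Im (f t) @[t --> F] --> complex.Im l.
Proof.
apply: (@cvg_R_of_normc _ _ _ f l (@complex.Im R)) => z w.
by rewrite -[_ - _](raddfB (@complex.Im R : {additive R[i] -> R})) Im_le_normc.
Qed.

Lemma dist_normc (z w : R[i]) : `|normc z - normc w| <= normc (z - w).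
Proof.
rewrite ler_distl; apply/andP; split.
  rewrite lerBlDr; have := ler_normcD z (w - z).
  by rewrite addrC subrK [normc (w - z)]normcBC.
by have := ler_normcD w (z - w); rewrite addrC subrK.
Qed.

Lemma cvg_normc (T : Type) (F : set_system T) {FF : Filter F} (f : T -> C1 R) (l : C1 R) :
  f @ F --> l -> normc (f t) @[t --> F] --> normc l.
Proof.
by apply: (@cvg_R_of_normc _ _ _ f l (@normc R)) => z w; exact: dist_normc.
Qed.

Lemma cvg_complex (T : Type) (F : set_system T) {FF : Filter F} (f g : T -> R) (a b : R) :
  f @ F --> a -> g @ F --> b ->
  ((fun t => (f t +i* g t) : C1 R) @ F --> ((a +i* b) : C1 R)).
Proof.
move=> /cvgrPdist_lt fa /cvgrPdist_lt gb; apply/cvg_C1P => e e0.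
have e2 : 0 < e / 2 by rewrite divr_gt0.
near=> t; apply: (le_lt_trans (normc_le_ReIm _)) => /=.
rewrite [ltRHS]splitr ltrD//= distrC; near: t; [exact: fa|exact: gb].
Unshelve. all: by end_near. Qed.

Lemma cvg_cexp (T : Type) (F : set_system T) {FF : Filter F} (f : T -> C1 R) (l : C1 R) :
  f @ F --> l -> ((fun t => cexp (f t) : C1 R) @ F --> (cexp l : C1 R)).
Proof.
move=> fl; apply: cvg_complex; apply: cvgM.
- by apply: continuous_cvg (cvg_Re fl); exact: continuous_expR.
- by apply: continuous_cvg (cvg_Im fl); exact: continuous_cos.
- by apply: continuous_cvg (cvg_Re fl); exact: continuous_expR.
- by apply: continuous_cvg (cvg_Im fl); exact: continuous_sin.
Qed.

Lemma differentiable_eps (V W : normedModType R[i]) (f : V -> W) (x : V)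
    (df : {linear V -> W}) : continuous df ->
  (forall e : R, 0 < e -> \forall h \near (0 : V),
      `|f (h + x) - f x - df h| <= e%:C * `|h|) -> differentiable f x.
Proof.
move=> dfc H; have dE : f \o shift x = cst (f x) + df +o_ 0 id.
  apply/eqaddoP => e e0; have [eE e0'] := gt0_complexE e0.
  have := H _ e0'; rewrite -eE; apply: filterS => h /=.
  by rewrite /= opprD addrA.
have d := diff_unique dfc dE.
by apply/diff_locallyP; rewrite d.
Qed.

End Topology.

(** * Complex derivatives by first-order comparison *)

Section Derivatives.
Import Normc.
Local Open Scope complex_scope.
Context {R : realType}.

(** Tangency to a differentiable function transports differentiability. Comparison with linear maps
    later treats [cexp] and [worm_L] without Cauchy-Riemann equations. *)
Lemma differentiable_near (V W : normedModType R[i]) (f g : V -> W) (x : V) :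
  differentiable g x ->
  (forall e : R, 0 < e -> \forall h \near (0 : V),
      `|(f (h + x) - f x) - (g (h + x) - g x)| <= e%:C * `|h|) ->
  differentiable f x.
Proof.
move=> dg H; apply: (@differentiable_eps _ _ _ _ _ ('d g x)).
  exact: diff_continuous.
move=> e e0; have e2 : 0 < e / 2 by rewrite divr_gt0.
have := diff_locally dg => /eqaddoP /(_ (e / 2)%:C).
rewrite ltcR => /(_ e2) G; near=> h.
rewrite (_ : _ - _ = ((f (h + x) - f x) - (g (h + x) - g x)) +
   ((g (h + x) - g x) - 'd g x h)); last by rewrite addrA subrK.
apply: (le_trans (ler_normD _ _)).
have -> : e%:C = (e / 2)%:C + (e / 2)%:C :> R[i] by rewrite -rmorphD -splitr.
rewrite mulrDl lerD//; last first.
  near: h; apply: filterS G => h /=.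
  by rewrite /= opprD addrA.
by near: h; exact: H.
Unshelve. all: by end_near. Qed.

Lemma is_derive_near0 (f : R -> R) (df : R) : is_derive (0 : R) 1 f df ->
  forall e, 0 < e -> exists2 d, 0 < d &
    forall x, `|x| < d -> `|f x - f 0 - x * df| <= e * `|x|.
Proof.
move=> [fd fE] e e0; have /derivable1_diffP fdiff := fd.
have /eqaddoP /(_ e e0) := diff_locally fdiff.
move=> /nbhs_ballP[d /= d0 H]; exists d => // x xd.
have := H x; rewrite -ball_normE /= sub0r normrN => /(_ xd).
rewrite diff1E// derive1E fE.
rewrite (_ : (_ - _) x = f (x + 0) - (f 0 + x * df)) //.
by rewrite addr0 opprD addrA.
Qed.

(** The complex derivative of [cexp] at 0 is 1, obtained from the real first-order expansions of
    [expR], [cos] and [sin]. *)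
Lemma cexp_first_order (e : R) : 0 < e -> exists2 d, 0 < d &
  forall w, normc w < d -> normc (cexp w - 1 - w) <= e * normc w.
Proof.
move=> e0; have e8 : 0 < e / 8 by rewrite divr_gt0.
(* The divisor 8 is the sum of the constants 3 and 5 in the bounds [A] and [B] below for the real
   and the imaginary part. *)
have [k [k0 k1 ke]] : exists k, [/\ 0 < k, k <= 1 & k <= e / 8].
  by exists (Num.min (e / 8) 1); rewrite lt_min e8 ltr01 !ge_min !lexx orbT.
have [d1 d10 H1] := is_derive_near0 (@is_derive_expR _ (0 : R)) k0.
have [d2 d20 H2] := is_derive_near0 (@is_derive_cos _ (0 : R)) k0.
have [d3 d30 H3] := is_derive_near0 (@is_derive_sin _ (0 : R)) k0.
exists (Num.min k (Num.min d1 (Num.min d2 d3))).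
  by rewrite !lt_min k0 d10 d20.
move=> [x y]; rewrite !lt_min => /and4P[nk n1 n2 n3].
have nx : `|x| <= normc (x +i* y) := Re_le_normc (x +i* y).
have ny : `|y| <= normc (x +i* y) := Im_le_normc (x +i* y).
move: nk n1 n2 n3 nx ny; set n := normc (x +i* y) => nk n1 n2 n3 nx ny.
have := H1 x (le_lt_trans nx n1); rewrite expR0 mulr1 => h1.
have := H2 y (le_lt_trans ny n2); rewrite cos0 sin0 oppr0 mulr0 subr0 => h2.
have := H3 y (le_lt_trans ny n3); rewrite sin0 subr0 cos0 mulr1 => h3.
have n0 : 0 <= n := normc_ge0 _.
have kn : k * `|x| <= k * n by rewrite ler_pM2l.
have kn' : k * `|y| <= k * n by rewrite ler_pM2l.
have ex2 : expR x <= 3.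
  move: h1; rewrite ler_norml => /andP[_ h1].
  have : x <= `|x| by exact: ler_norm.
  have : k * n <= n by rewrite ler_piMl.
  lra.
have ex0 := expR_ge0 x.
apply: (le_trans (normc_le_ReIm _)); rewrite /=.
have A : `|expR x * cos y - 1 - x| <= 3 * (k * n).
  rewrite (_ : _ - _ = (expR x - 1 - x) * cos y + (1 + x) * (cos y - 1)); last ring.
  apply: (le_trans (ler_normD _ _)); rewrite !normrM.
  have : `|expR x - 1 - x| * `|cos y| <= k * n * 1.
    by rewrite ler_pM// ?cos_max//; exact: le_trans h1 kn.
  have : `|1 + x| * `|cos y - 1| <= 2 * (k * n).
    rewrite ler_pM//; last exact: le_trans h2 kn'.
    by apply: (le_trans (ler_normD _ _)); rewrite normr1; lra.
  lra.
have B : `|expR x * sin y - 0 - y| <= 5 * (k * n).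
  rewrite (_ : _ - _ = expR x * (sin y - y) + (expR x - 1) * y); last ring.
  apply: (le_trans (ler_normD _ _)); rewrite !normrM.
  have : `|expR x| * `|sin y - y| <= 3 * (k * n).
    by rewrite (ger0_norm ex0) ler_pM//; exact: le_trans h3 kn'.
  have : `|expR x - 1| * `|y| <= (2 * k) * n.
    rewrite ler_pM//.
    rewrite (_ : _ - _ = (expR x - 1 - x) + x); last ring.
    apply: (le_trans (ler_normD _ _)).
    have : k * n <= k by rewrite ler_piMr ?(ltW k0)//; lra.
    lra.
  lra.
apply: (le_trans (lerD A B)).
have : k * n <= e / 8 * n by rewrite ler_wpM2r.
lra.
Qed.

Lemma differentiable_cexp (a : C1 R) : differentiable (fun z : C1 R => cexp z : C1 R) a.
Proof.
apply: (@differentiable_near _ _ _ (fun z : C1 R => (cexp a * z : C1 R))).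
  apply: (@differentiableM R[i] (C1 R) (cst (cexp a : R[i])) id) => //.
move=> e e0; have ca := normc_gt0 (cexp a); rewrite cexp_neq0 in ca.
have [d d0 H] := cexp_first_order (divr_gt0 e0 ca).
apply/near0_C1P; exists d => // w /H wd.
rewrite !normc_norm -rmorphM lecR.
rewrite (_ : _ - _ = cexp a * (cexp w - 1 - w)); last first.
  by rewrite [w + a]addrC cexpD; ring.
rewrite normcM; apply: (le_trans (ler_wpM2l (ltW ca) wd)).
by rewrite mulrA mulrCA mulfV ?mulr1// gt_eqF.
Qed.

End Derivatives.

(** * Geometry of the worm domain and holomorphy of [worm_L] *)

Section WormGeometry.
Import Normc.
Local Open Scope complex_scope.
Context {R : realType}.
Implicit Types (z : C2 R) (mu : R).

(** The number under the principal logarithm in [worm_L]. On the domain it lies in the disk of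
    radius 1 about 1, hence in the right half-plane, where [carg] is continuous. *)
Definition worm_zeta z : R[i] := z.1 * cexp (0 -i* worm_angle z).

Lemma cexp_iN (t : R) : cexp (0 +i* t) * cexp (0 -i* t) = 1.
Proof.
rewrite -cexpD -cexp0; congr cexp; apply/eqP.
by rewrite eq_complex /= addr0 subrr !eqxx.
Qed.

Lemma normc_cexp_i (t : R) : normc (cexp (0 +i* t)) = 1.
Proof. by rewrite normc_cexp /= expR0. Qed.

Lemma normc_zeta z : normc (worm_zeta z) = normc (z.1 : R[i]).
Proof. by rewrite normcM normc_cexp_i mulr1. Qed.

Lemma zeta_disk mu z : truncated_worm mu z -> normc (worm_zeta z - 1) < 1.
Proof.
move=> [_ z1 _]; rewrite -(@ltr_pXn2r _ 2) ?nnegrE ?normc_ge0// expr1n.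
rewrite -(cexp_iN (worm_angle z)) -mulrBl normcM normc_cexp_i mulr1.
exact: z1.
Qed.

Lemma zeta_Re mu z : truncated_worm mu z ->
  normc (z.1 : R[i]) ^+ 2 < 2 * complex.Re (worm_zeta z).
Proof.
move=> /zeta_disk H; rewrite -normc_zeta.
have : normc (worm_zeta z - 1) ^+ 2 < 1 by rewrite exprn_ilt1 ?normc_ge0.
case: (worm_zeta z) => x y; rewrite !sqr_normcE /= oppr0 addr0; lra.
Qed.

Lemma zeta_Re_gt0 mu z : truncated_worm mu z -> 0 < complex.Re (worm_zeta z).
Proof.
move=> /zeta_Re; have := sqr_ge0 (normc (z.1 : R[i])); lra.
Qed.

Lemma z1_gt0 mu z : truncated_worm mu z -> 0 < normc (z.1 : R[i]).
Proof. by move=> /zeta_Re_gt0 H; rewrite -normc_zeta normc_gt0_Re. Qed.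

(** In polar coordinates the disk of radius 1 about 1 is [|zeta| < 2 cos (arg zeta)]. This form
    controls the cusp of the range of [worm_u]. *)
Lemma z1_lt_cos mu z : truncated_worm mu z ->
  normc (z.1 : R[i]) < 2 * cos (carg (worm_zeta z)).
Proof.
move=> Dz; rewrite cos_carg ?(zeta_Re_gt0 Dz)// normc_zeta.
rewrite mulrA ltr_pdivlMr ?(z1_gt0 Dz)// -expr2; exact: zeta_Re Dz.
Qed.

Lemma z1_lt2 mu z : truncated_worm mu z -> normc (z.1 : R[i]) < 2.
Proof.
move=> /z1_lt_cos; have := cos_le1 (carg (worm_zeta z)); lra.
Qed.

Lemma worm_LE z : worm_L z = clog (worm_zeta z) + (0 +i* worm_angle z).
Proof. by []. Qed.

Lemma Re_worm_L z : complex.Re (worm_L z) = ln (normc (z.1 : R[i])).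
Proof. by rewrite worm_LE /= addr0 normc_zeta. Qed.

Lemma Im_worm_L z : complex.Im (worm_L z) = carg (worm_zeta z) + worm_angle z.
Proof. by rewrite worm_LE. Qed.

Lemma cexp_worm_L mu z : truncated_worm mu z -> cexp (worm_L z) = z.1.
Proof.
move=> Dz; rewrite worm_LE cexpD clogK ?(zeta_Re_gt0 Dz)// /worm_zeta -mulrA.
by rewrite [X in _ * X]mulrC cexp_iN mulr1.
Qed.

Lemma cvg_z1 z : (fun w : C2 R => w.1 : C1 R) @ nbhs z --> (z.1 : C1 R).
Proof. exact: cvg_fst. Qed.

Lemma cvg_z2 z : (fun w : C2 R => w.2 : C1 R) @ nbhs z --> (z.2 : C1 R).
Proof. exact: cvg_snd. Qed.

Lemma cvg_worm_angle z : z.2 != 0 -> worm_angle w @[w --> z] --> worm_angle z.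
Proof.
move=> z0; apply: (@continuous_cvg _ _ _ _ _ _ (@ln R)).
  by apply: continuous_ln; rewrite exprn_gt0// normc_gt0.
apply: (@continuous_cvg _ _ _ _ _ _ (fun x : R => x ^+ 2)).
  exact: exprn_continuous.
exact: cvg_normc (@cvg_z2 z).
Qed.

Lemma cvg_zeta z : z.2 != 0 ->
  (fun w => worm_zeta w : C1 R) @ nbhs z --> (worm_zeta z : C1 R).
Proof.
move=> z0; apply: cvgM; first exact: cvg_z1.
apply: cvg_cexp; apply: cvg_complex; first exact: cvg_cst.
by apply: cvgN; exact: cvg_worm_angle.
Qed.

Lemma near_worm mu z : truncated_worm mu z ->
  \forall w \near z, truncated_worm mu w.
Proof.
move=> [z0 z1 zm].
have A : \forall w \near z, w.2 != 0.
  have nz0 : 0 < normc (z.2 : R[i]) by rewrite normc_gt0.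
  near=> w; rewrite -normc_gt0; near: w.
  exact: cvgr_gt _ (cvg_normc (@cvg_z2 z)) _ nz0.
have B : \forall w \near z, `|worm_angle w| < mu.
  exact: cvgr_lt _ (cvg_norm (cvg_worm_angle z0)) _ zm.
have C : \forall w \near z,
    normc (w.1 - cexp (0 +i* worm_angle w)) ^+ 2 < 1.
  suff H : normc (w.1 - cexp (0 +i* worm_angle w)) ^+ 2 @[w --> z] -->
      normc (z.1 - cexp (0 +i* worm_angle z)) ^+ 2.
    exact: cvgr_lt _ H _ z1.
  apply: (@continuous_cvg _ _ _ _ _ _ (fun x : R => x ^+ 2)).
    exact: exprn_continuous.
  apply: cvg_normc.
  apply: (@cvgB R[i] (C1 R) _ _ _ (fun w : C2 R => w.1 : C1 R)
    (fun w => cexp (0 +i* worm_angle w) : C1 R)); first exact: cvg_z1.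
  apply: cvg_cexp; apply: cvg_complex; first exact: cvg_cst.
  exact: cvg_worm_angle.
by near=> w; split; near: w.
Unshelve. all: by end_near. Qed.

Lemma cvg_worm_L mu z : truncated_worm mu z ->
  (fun w => worm_L w : C1 R) @ nbhs z --> (worm_L z : C1 R).
Proof.
move=> Dz; have z20 : z.2 != 0 by case: Dz.
have zz := cvg_zeta z20; have Rz := zeta_Re_gt0 Dz.
have nr : \forall w \near z, truncated_worm mu w := near_worm Dz.
(* On the whole domain, hence near [z], the argument may be replaced by an arctangent, whose
   continuity is known. *)
have E w : truncated_worm mu w -> worm_L w = (ln (normc (w.1 : R[i])) +i*
  (atan (complex.Im (worm_zeta w) / complex.Re (worm_zeta w)) + worm_angle w)).
  move=> Dw; apply/eqP; rewrite eq_complex Re_worm_L Im_worm_L /=.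
  by rewrite carg_atan ?eqxx// (zeta_Re_gt0 Dw).
rewrite (E _ Dz).
apply: (@cvg_trans _ ((fun w : C2 R => (ln (normc (w.1 : R[i])) +i*
  (atan (complex.Im (worm_zeta w) / complex.Re (worm_zeta w)) + worm_angle w))
  : C1 R) @ nbhs z)).
  by apply: near_eq_cvg; apply: filterS nr => w /E ->.
apply: cvg_complex.
  apply: (@continuous_cvg _ _ _ _ _ _ (@ln R)); first by apply: continuous_ln; rewrite (z1_gt0 Dz).
  exact: cvg_normc (@cvg_z1 z).
apply: cvgD; last exact: cvg_worm_angle.
apply: (@continuous_cvg _ _ _ _ _ _ (@atan R)); first exact: continuous_atan.
apply: cvgM; first exact: cvg_Im.
by apply: cvgV; [rewrite gt_eqF|exact: cvg_Re].
Qed.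

Lemma differentiable_z1 z : differentiable (fun w : C2 R => w.1 : C1 R) z.
Proof.
have fc : continuous (fst : C2 R -> C1 R) by move=> w; exact: cvg_fst.
have := @linear_differentiable R[i] (C2 R) (C1 R) fst z fc; exact.
Qed.

Lemma differentiable_z2 z : differentiable (fun w : C2 R => w.2 : C1 R) z.
Proof.
have fc : continuous (snd : C2 R -> C1 R) by move=> w; exact: cvg_snd.
have := @linear_differentiable R[i] (C2 R) (C1 R) snd z fc; exact.
Qed.

Lemma norm_fst_le (h : C2 R) : `|h.1| <= `|h|.
Proof.
rewrite prod_normE /= /Order.max.
by case: ifP => [/ltW|].
Qed.

(** The formula for [L] contains the non-holomorphic [worm_angle], yet [L] is a continuous logarithm
    of [z1]. Its increment [w] satisfies [cexp w - 1 = h.1 / z.1], so inverting the first-order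
    expansion of [cexp] gives the derivative [1 / z.1] in the first variable and 0 in the second. *)
Lemma differentiable_worm_L mu z : truncated_worm mu z ->
  differentiable (fun w => worm_L w : C1 R) z.
Proof.
move=> Dz; have z10 : 0 < normc (z.1 : R[i]) := z1_gt0 Dz.
have z1n : (z.1 : R[i]) != 0 by rewrite -normc_gt0.
apply: (@differentiable_near _ _ _ _ (fun w : C2 R => (w.1 * (z.1)^-1 : C1 R))).
  apply: (@differentiableM R[i] (C2 R) (fun w => w.1) (cst (z.1 : R[i])^-1)) => //.
  exact: differentiable_z1.
(* The bound 1/2 allows the inversion [normc w <= 2 * normc (h.1 / z.1)]; the other bound turns the
   resulting error into [e] times the norm of [h.1]. *)
move=> e e0; pose k := Num.min 2^-1 (e * normc (z.1 : R[i]) / 2).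
have k0 : 0 < k by rewrite lt_min invr_gt0 ltr0n /= divr_gt0 ?mulr_gt0.
have k1 : k <= 2^-1 by rewrite ge_min lexx.
have k2 : k <= e * normc (z.1 : R[i]) / 2 by rewrite ge_min lexx orbT.
have [d d0 H] := cexp_first_order k0.
have sh : h + z @[h --> (0 : C2 R)] --> z.
  by rewrite -[X in _ --> X]add0r; apply: cvgD; [exact: cvg_id|exact: cvg_cst].
have n1 : \forall h \near (0 : C2 R), truncated_worm mu (h + z).
  exact: sh (near_worm Dz).
have n2 : \forall h \near (0 : C2 R), normc (worm_L (h + z) - worm_L z) < d.
  have /cvg_C1P/(_ d d0) := cvg_worm_L Dz; exact: sh.
near=> h.
have D' : truncated_worm mu (h + z) by near: h.
have W : normc (worm_L (h + z) - worm_L z) < d by near: h.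
have := H _ W; set w := worm_L _ - _ => wk.
have Ew : cexp w - 1 = h.1 / z.1.
  rewrite /w cexpD cexpN (cexp_worm_L D') (cexp_worm_L Dz) /= mulrDl.
  by rewrite divff// addrK.
rewrite Ew in wk.
have hn : normc (h.1 / z.1) <= normc (h.1 : R[i]) / normc (z.1 : R[i]).
  by rewrite normcM normcV.
have w2 : normc w <= 2 * normc (h.1 / z.1).
  have := ler_normcD (h.1 / z.1) (- (h.1 / z.1 - w)).
  rewrite opprB addrC subrK [normc (w - _)]normcBC => A.
  have : k * normc w <= 2^-1 * normc w by rewrite ler_wpM2r ?normc_ge0.
  lra.
apply: (@le_trans _ _ (e%:C * `|h.1|)); last first.
  by rewrite ler_wpM2l ?norm_fst_le// lecR ltW.
rewrite !normc_norm -rmorphM lecR.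
rewrite (_ : _ - (_ - _) = - (h.1 / z.1 - w)); last first.
  by rewrite /w /= mulrDl; ring.
rewrite normc_opp; apply: (le_trans wk).
have : k * normc w <= k * (2 * (normc (h.1 : R[i]) / normc (z.1 : R[i]))).
  by rewrite ler_wpM2l ?(ltW k0)//; lra.
move=> /le_trans; apply.
rewrite (_ : e * _ = e * normc (z.1 : R[i]) / 2 *
  (2 * (normc (h.1 : R[i]) / normc (z.1 : R[i])))); last first.
  by field; rewrite gt_eqF.
by rewrite ler_wpM2r// mulr_ge0// divr_ge0 ?normc_ge0.
Unshelve. all: by end_near. Qed.

End WormGeometry.

(** * Modulus and holomorphy of the monomials *)

Section WormMonomials.
Import Normc.
Local Open Scope complex_scope.
Context {R : realType}.
Implicit Types (z : C2 R) (mu c : R) (j : int).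

(* The family [worm_H] with a real exponent [c] in place of [c0 + nu * l]. *)
Definition worm_G c j : C2 R -> C1 R :=
  fun z => worm_E (c +i* ((j + 1)%:~R / 2)) z * (z.2 : R[i]) ^ j.

Lemma normc_exprz (w : R[i]) j : normc (w ^ j) = normc w ^ j.
Proof.
by case: j => n; rewrite ?NegzE -?exprnN ?normcV ?normcX // -exprnP normcX.
Qed.

Lemma normc_z2 z : z.2 != 0 -> normc (z.2 : R[i]) = expR (worm_angle z / 2).
Proof.
move=> z0; have n0 : 0 < normc (z.2 : R[i]) by rewrite normc_gt0.
rewrite /worm_angle lnXn// mulr2n.
by rewrite (_ : _ / 2 = ln (normc (z.2 : R[i]))) ?lnK//; field.
Qed.

Lemma expR_int (x : R) j : expR x ^ j = expR (j%:~R * x).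
Proof.
case: j => n; first by rewrite -exprnP expRM_natl.
by rewrite NegzE -exprnN mulrNz mulNr expRN expRM_natl.
Qed.

(** With [t] the worm angle, the factor [|z2|^j = exp (j t / 2)] cancels the dependence on [j] that
    comes through [t]: only [- t / 2] is left, and [j] acts through the argument of zeta alone. *)
Lemma normc_worm_G mu c j z : truncated_worm mu z ->
  normc (worm_G c j z) = expR (c * ln (normc (z.1 : R[i]))
    - (j + 1)%:~R / 2 * carg (worm_zeta z) - worm_angle z / 2).
Proof.
move=> Dz; rewrite normcM normc_exprz normc_z2; last by case: Dz.
rewrite normc_cexp expR_int -expRD; congr expR.
have := Re_worm_L z; have := Im_worm_L z; case: (worm_L z) => a b /= -> ->.
by rewrite intrD; field.
Qed.

Lemma worm_G_bound mu c j : exists2 K : R, 0 < K & forall z,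
  truncated_worm mu z ->
  normc (worm_G c j z) <= K * normc (z.1 : R[i]) `^ c.
Proof.
exists (expR (`|(j + 1)%:~R / 2| * (pi / 2) + mu / 2)) => [|z Dz].
  exact: expR_gt0.
rewrite (normc_worm_G _ _ Dz) /powR gt_eqF ?(z1_gt0 Dz)// -expRD ler_expR.
have H1 : - ((j + 1)%:~R / 2 * carg (worm_zeta z)) <= `|(j + 1)%:~R / 2| * (pi / 2).
  rewrite -mulrN; apply: (le_trans (ler_norm _)); rewrite normrM normrN.
  by rewrite ler_wpM2l// ltW// carg_bound// (zeta_Re_gt0 Dz).
have H2 : - (worm_angle z / 2) <= mu / 2.
  by case: Dz => _ _; rewrite ltr_norml => /andP[]; lra.
lra.
Qed.

Lemma differentiable_exprz j z : z.2 != 0 ->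
  differentiable (fun w : C2 R => (w.2 : R[i]) ^ j : C1 R) z.
Proof.
move=> z0.
have X n : differentiable (fun w : C2 R => (w.2 : R[i]) ^+ n : C1 R) z.
  elim: n => [|n IH]; first exact: differentiable_cst.
  have E : (fun w : C2 R => (w.2 : R[i]) ^+ n.+1 : C1 R) =
      (fun w => w.2 : R[i]) * (fun w => (w.2 : R[i]) ^+ n).
    by apply/funext => w; rewrite exprS.
  rewrite E.
  exact: (@differentiableM R[i] (C2 R) (fun w => w.2 : R[i])
    (fun w => (w.2 : R[i]) ^+ n) z (differentiable_z2 z) IH).
case: j => n; first exact: X.
have zn : (z.2 : R[i]) ^+ n.+1 != 0 by rewrite expf_neq0.
exact: (@differentiableV R[i] (C2 R) (fun w : C2 R => (w.2 : R[i]) ^+ n.+1) z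
  (X n.+1) zn).
Qed.

Lemma differentiable_worm_G mu c j z : truncated_worm mu z ->
  differentiable (worm_G c j) z.
Proof.
move=> Dz; have z0 : z.2 != 0 by case: Dz.
apply: (@differentiableM R[i] (C2 R) (fun w => worm_E _ w : R[i])
   (fun w => (w.2 : R[i]) ^ j)); last exact: differentiable_exprz.
apply: (@differentiable_comp R[i] (C2 R) (C1 R) (C1 R)
   (fun w => (c +i* ((j + 1)%:~R / 2)) * worm_L w : C1 R)
   (fun w => cexp w : C1 R)); last exact: differentiable_cexp.
apply: (@differentiableM R[i] (C2 R) (cst (c +i* ((j + 1)%:~R / 2) : R[i]))
   (fun w => worm_L w : R[i])); first exact: differentiable_cst.
exact: differentiable_worm_L Dz.
Qed.

End WormMonomials.

(** * Boxes in four real dimensions and measurability *)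

Section Boxes.
Import Normc.
Local Open Scope complex_scope.
Context {R : realType}.
Local Notation mR := (measurableTypeR R).
Local Notation R4 := ((mR * mR) * (mR * mR))%type.
Implicit Types (p q : R4) (U : set R4).

(** The measure is an explicit product, which is why boxes carry all volume estimates; the two radii
    let [z1] shrink while [z2] stays bounded. *)
Definition box p (r s : R) : set R4 :=
  (ball (p.1.1 : R) r `*` ball (p.1.2 : R) r)
    `*` (ball (p.2.1 : R) s `*` ball (p.2.2 : R) s).

Lemma boxP p r s q : box p r s q <->
  [/\ `|(p.1.1 : R) - q.1.1| < r, `|(p.1.2 : R) - q.1.2| < r,
      `|(p.2.1 : R) - q.2.1| < s & `|(p.2.2 : R) - q.2.2| < s].
Proof. by split=> [[] [] ? ? [] ? ?|[] ? ? ? ?]; do ?split. Qed.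

Lemma measurable_box p r s : measurable (box p r s).
Proof. by do 2 apply: measurableX; apply: measurable_realfun.measurable_ball. Qed.

Lemma lebesgue_measure4_box p r s : 0 <= r -> 0 <= s ->
  lebesgue_measure4 (box p r s) =
  (((r *+ 2) * (r *+ 2)) * ((s *+ 2) * (s *+ 2)))%:E.
Proof.
move=> r0 s0; have mb (x t : R) : measurable (ball x t : set mR).
  exact: measurable_realfun.measurable_ball.
have m2 x y t : 0 <= t ->
    lebesgue_measure2 ((ball (x : R) t : set mR) `*` (ball (y : R) t : set mR)) =
    ((t *+ 2) * (t *+ 2))%:E.
  move=> t0; rewrite /lebesgue_measure2; etransitivity; first exact: product_measure1E.
  by rewrite EFinM; congr (_ * _)%E; exact: lebesgue_measure_ball.
rewrite /lebesgue_measure4 /box; etransitivity.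
  by apply: product_measure1E; exact: measurableX.
by rewrite [RHS]EFinM; congr (_ * _)%E; exact: m2.
Qed.

(** Such a set is the union of the countably many boxes with rational centre and radius
    [1 / (k + 1)] that it contains. *)
Lemma measurable_open4 U :
  (forall p, U p -> exists2 e : R, 0 < e & box p e e `<=` U) -> measurable U.
Proof.
move=> oU; pose c (a : ((rat * rat) * (rat * rat)) * nat) : R4 :=
  ((ratr a.1.1.1, ratr a.1.1.2), (ratr a.1.2.1, ratr a.1.2.2)).
pose F a := if `[< box (c a) a.2.+1%:R^-1 a.2.+1%:R^-1 `<=` U >]
  then box (c a) a.2.+1%:R^-1 a.2.+1%:R^-1 else set0.
suff -> : U = \bigcup_a F a.
  apply: countable_bigcupT_measurable; first exact: countableP.
  by move=> a; rewrite /F; case: ifP => _; [exact: measurable_box|].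
apply/seteqP; split=> [p Up|p [a _]]; last first.
  by rewrite /F; case: ifP => // /asboolP; apply.
have [e e0 pe] := oU p Up.
(* Radius below [e / 2]: a rational box that contains [p] then lies in the box of radius [e] about
   [p]. *)
have [k ke] : exists k : nat, k.+1%:R^-1 < e / 2.
  have [k _ H] := near_infty_natSinv_lt (PosNum (divr_gt0 e0 (ltr0n _ 2))).
  by exists k; have := H k (leqnn k).
set r : R := k.+1%:R^-1 in ke; have r0 : 0 < r by rewrite invr_gt0.
have ap (x : R) : exists a : rat, `|ratr a - x| < r.
  have /rat_in_itvoo[a] : x - r < x + r by lra.
  by rewrite in_itv /= => /andP[A B]; exists a; rewrite ltr_distl A B.
have [a1 h1] := ap p.1.1; have [a2 h2] := ap p.1.2.
have [a3 h3] := ap p.2.1; have [a4 h4] := ap p.2.2.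
exists (((a1, a2), (a3, a4)), k) => //; rewrite /F; case: ifPn => [_|/asboolPn []].
  by apply/boxP; split.
move=> q /boxP[/= q1 q2 q3 q4]; apply: pe; apply/boxP.
have tr (x y z : R) : `|x - y| < r -> `|x - z| < r -> `|y - z| < e.
  move=> xy xz; have := ler_distD x y z; rewrite [`|y - x|]distrC; lra.
by split; [exact: tr h1 q1|exact: tr h2 q2|exact: tr h3 q3|exact: tr h4 q4].
Qed.

Lemma nbhs_box (p : R4) (A : set (C2 R)) : nbhs (to_C2 p) A ->
  exists2 e : R, 0 < e & box p e e `<=` to_C2 @^-1` A.
Proof.
move=> [[A1 A2] /= [/nbhs_C1P[e1 e10 H1] /nbhs_C1P[e2 e20 H2]] HA].
pose e := Num.min (e1 / 2) (e2 / 2).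
have e0 : 0 < e by rewrite lt_min !divr_gt0.
have l1 : e <= e1 / 2 by rewrite ge_min lexx.
have l2 : e <= e2 / 2 by rewrite ge_min lexx orbT.
exists e => // q /boxP[q1 q2 q3 q4]; apply: HA; split => /=.
  apply: H1; apply: (le_lt_trans (normc_le_ReIm _)) => /=.
  rewrite (distrC q.1.1) (distrC q.1.2); lra.
apply: H2; apply: (le_lt_trans (normc_le_ReIm _)) => /=.
rewrite (distrC q.2.1) (distrC q.2.2); lra.
Qed.

Lemma measurable_preimage_open (D : set (C2 R)) :
  (forall z, D z -> \forall w \near z, D w) -> measurable (@to_C2 R @^-1` D).
Proof. by move=> oD; apply: measurable_open4 => p /oD /nbhs_box. Qed.

Lemma measurable_normc_sqr (D : set (C2 R)) (f : C2 R -> C1 R) :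
  (forall z, D z -> \forall w \near z, D w) ->
  (forall z, D z -> {for z, continuous f}) ->
  measurable_fun (to_C2 @^-1` D) (fun p => (normc (f (to_C2 p)) ^+ 2 : R)%:E).
Proof.
move=> oD cf; apply/measurable_EFinP.
apply: (measurability _ (RGenOpens.measurableE R)).
move=> _ [_ [a [b ->] <-]].
have -> : to_C2 @^-1` D `&` (fun p => normc (f (to_C2 p)) ^+ 2) @^-1` `]a, b[ =
  @to_C2 R @^-1` (D `&` [set z | normc (f z) ^+ 2 \in `]a, b[]) by [].
apply: measurable_preimage_open => z [Dz fz].
have fc : normc (f w) ^+ 2 @[w --> z] --> normc (f z) ^+ 2.
  apply: (@continuous_cvg _ _ _ _ _ _ (fun x : R => x ^+ 2)).
    exact: exprn_continuous.
  exact: cvg_normc (cf _ Dz).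
move: fz; rewrite /= in_itv /= => /andP[fa fb].
near=> w; split; first by near: w; exact: oD.
rewrite /= in_itv /=; apply/andP; split; near: w.
- exact: cvgr_gt _ fc _ fa.
- exact: cvgr_lt _ fc _ fb.
Unshelve. all: by end_near. Qed.

End Boxes.

(** * Square integrability of functions bounded by a power of the modulus of z1 *)

Section Integrability.
Import Normc.
Local Open Scope complex_scope.
Context {R : realType}.
Local Notation mR := (measurableTypeR R).
Local Notation R4 := ((mR * mR) * (mR * mR))%type.
Implicit Types (mu c : R) (f : C2 R -> C1 R).

Lemma geometric_sum_le (q : R) n : 0 <= q < 1 ->
  \sum_(0 <= k < n) q ^+ k <= (1 - q)^-1.
Proof.
move=> /andP[q0 q1]; have q1' : 0 < 1 - q by rewrite subr_gt0.
rewrite -[leRHS]mul1r ler_pdivlMr//.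
have -> : (\sum_(0 <= k < n) q ^+ k) * (1 - q) = 1 - q ^+ n.
  elim: n => [|n IH]; first by rewrite big_geq// mul0r expr0 subrr.
  by rewrite big_nat_recr//= mulrDl IH exprS; ring.
by rewrite gerBl exprn_ge0.
Qed.

Lemma geometric_eseries_fin (C q : R) : 0 <= C -> 0 <= q < 1 ->
  (\sum_(0 <= k <oo) (C * q ^+ k)%:E < +oo)%E.
Proof.
move=> C0 q01; have /andP[q0 q1] := q01.
apply: (@le_lt_trans _ _ (C / (1 - q))%:E); last exact: ltry.
apply: lime_le.
  by apply: is_cvg_nneseries => k _ _; rewrite lee_fin mulr_ge0// exprn_ge0.
apply: nearW => n; rewrite sumEFin lee_fin -mulr_sumr ler_wpM2l//.
exact: geometric_sum_le.
Qed.

Lemma dyadic_shell (r : R) : 0 < r -> r < 2 ->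
  exists k, 2^-1 ^+ k <= r < 2 * 2^-1 ^+ k.
Proof.
move=> r0 r2; have ex : exists k, 2^-1 ^+ k <= r.
  have [k _ H] := near_infty_natSinv_lt (PosNum r0).
  exists k; apply: le_trans (ltW (H k (leqnn k))).
  rewrite exprVn lef_pV2 ?posrE ?exprn_gt0 ?ltr0n//.
  by rewrite -natrX ler_nat ltn_expl.
(* Minimality of [k] gives the upper bound, except for [k = 0], where it is [r < 2]. *)
case: (ex_minnP ex) => [[|k]] kr kmin; [exists 0%N|exists k.+1]; rewrite kr/=.
  by rewrite expr0 mulr1.
rewrite exprS mulrA mulfV// mul1r ltNge; apply/negP => /kmin.
by rewrite ltnn.
Qed.

(* Splitting into dyadic shells in [z1] avoids polar coordinates. *)
Lemma worm_L2_fin mu c (K : R) f : -1 < c ->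
  (forall z, truncated_worm mu z -> {for z, continuous f}) ->
  (forall z, truncated_worm mu z ->
     normc (f z) <= K * normc (z.1 : R[i]) `^ c) ->
  (\int[lebesgue_measure4]_(p in @to_C2 R @^-1` truncated_worm mu)
      (normc (f (to_C2 p)) ^+ 2)%:E < +oo)%E.
Proof.
move=> c1 cf fK.
pose D := truncated_worm mu; pose D4 := @to_C2 R @^-1` D.
have mD : measurable D4 := measurable_preimage_open (@near_worm R mu).
(* On the shell [2^-k <= |z1| < 2 * 2^-k] the power [|z1|^c] is at most [M a^k], and the enclosing
   box has measure of order [4^-k]. The resulting series has ratio [a^2 / 4], below 1 because
   [c > -1] gives [a < 2]. *)
pose a := 2 `^ (- c) : R; pose M := Num.max 1 (2 `^ c) : R.
have a0 : 0 <= a by exact: powR_ge0.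
have M0 : 0 <= M by rewrite le_max ler01.
have a2 : a < 2.
  rewrite -[ltRHS]powRr1// /a /powR gt_eqF//= ltr_expR ltr_pM2r ?ln_gt0 ?ltr1n//.
  lra.
have q01 : 0 <= a ^+ 2 / 4 < 1.
  by rewrite divr_ge0 ?sqr_ge0//= ltr_pdivrMr// mul1r; nra.
pose B := expR (mu / 2).
have B0 : 0 <= B := expR_ge0 _.
pose A k := box ((0, 0), (0, 0)) (2 * 2^-1 ^+ k) B : set R4.
have mA k : measurable (A k) := measurable_box _ _ _.
pose g k (p : R4) := ((K * M) ^+ 2 * (a ^+ 2) ^+ k * \1_(A k) p)%:E.
have Kf z : D z -> exists k, [/\ normc (f z) <= K * M * a ^+ k,
    normc (z.1 : R[i]) < 2 * 2^-1 ^+ k & normc (z.2 : R[i]) < B].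
  move=> Dz; have z10 := z1_gt0 Dz.
  have [k /andP[k1 k2]] := dyadic_shell z10 (z1_lt2 Dz).
  exists k; split => //; last first.
    rewrite normc_z2; last by case: Dz.
    rewrite ltr_expR ltr_pM2r//; case: Dz => _ _.
    exact: le_lt_trans (ler_norm _).
  have := fK _ Dz => /le_trans; apply; rewrite -mulrA ler_wpM2l//.
    have := le_trans (normc_ge0 _) (fK _ Dz).
    by rewrite pmulr_lge0// powR_gt0.
  have h0 : (0 : R) < 2^-1 ^+ k by rewrite exprn_gt0.
  have -> : a ^+ k = (2^-1 ^+ k) `^ c.
    rewrite exprVn -(powR_invn k (ler0n R 2)) -(powR_mulrn k a0) -!powRrM.
    by congr powR; ring.
  (* The sign of [c] decides whether the power is largest at the outer or at the inner edge of the
     shell; [M] covers both cases. *)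
  have [c0|c0] := leP 0 c.
    apply: (@le_trans _ _ ((2 * 2^-1 ^+ k) `^ c)).
      rewrite ge0_ler_powR// ?nnegrE ?(ltW z10) ?(ltW k2)//.
    by rewrite powRM// ?(ltW h0)// ler_wpM2r ?powR_ge0// le_max lexx orbT.
  rewrite -[leLHS]mul1r ler_pM ?powR_ge0//; first by rewrite le_max lexx.
  rewrite -[c]opprK ![_ `^ - - c]powRN lef_pV2 ?posrE ?powR_gt0//.
  by rewrite ge0_ler_powR ?nnegrE ?oppr_ge0 ?(ltW c0) ?(ltW h0) ?(ltW z10)//.
have mg k : measurable_fun D4 (g k).
  apply/measurable_EFinP; apply: measurable_funM; first exact: measurable_cst.
  exact: measurable_indic.
have g0 k p : D4 p -> (0 <= g k p)%E.
  by move=> _; rewrite lee_fin mulr_ge0// mulr_ge0 ?sqr_ge0// exprn_ge0 ?sqr_ge0.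
apply: (@le_lt_trans _ _ (\int[lebesgue_measure4]_(p in D4) \sum_(0 <= k <oo) g k p)%E).
  apply: ge0_le_integral => //.
  - by move=> p _; rewrite lee_fin sqr_ge0.
  - exact: measurable_normc_sqr (@near_worm R mu) cf.
  - by apply: ge0_emeasurable_sum => // k p; move/g0.
  move=> p Dp; have [k [k1 k2 k3]] := Kf _ Dp.
  (* The single term of the shell containing the point already dominates. *)
  apply: (@le_trans _ _ (g k p)).
    rewrite lee_fin indicE mem_set; last first.
      apply/boxP; rewrite /= !sub0r !normrN; split.
      - exact: le_lt_trans (Re_le_normc (to_C2 p).1) k2.
      - exact: le_lt_trans (Im_le_normc (to_C2 p).1) k2.
      - exact: le_lt_trans (Re_le_normc (to_C2 p).2) k3.
      - exact: le_lt_trans (Im_le_normc (to_C2 p).2) k3.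
    rewrite mulr1 -exprM mulnC exprM -exprMn.
    by rewrite ler_pXn2r ?nnegrE ?normc_ge0// (le_trans (normc_ge0 _) k1).
  rewrite (nneseriesD1 (n := k))//=; last by move=> i _; exact: g0.
  by rewrite leeDl// nneseries_ge0// => i _ _; exact: g0.
rewrite integral_nneseries//.
have [C0 fin] : 0 <= (K * M) ^+ 2 * (16 * (4 * B ^+ 2)) /\
    (\sum_(0 <= k <oo) ((K * M) ^+ 2 * (16 * (4 * B ^+ 2)) * (a ^+ 2 / 4) ^+ k)%:E < +oo)%E.
  have C0 : 0 <= (K * M) ^+ 2 * (16 * (4 * B ^+ 2)).
    by rewrite mulr_ge0 ?sqr_ge0// mulr_ge0// mulr_ge0// sqr_ge0.
  by split=> //; exact: geometric_eseries_fin.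
apply: le_lt_trans fin; apply: lee_nneseries => [k _ _|k _].
  by apply: integral_ge0 => p; exact: g0.
rewrite /g; under eq_integral do rewrite EFinM.
rewrite ge0_integralZl//; last 2 first.
- by apply/measurable_EFinP; exact: measurable_indic.
- by rewrite lee_fin mulr_ge0 ?sqr_ge0// exprn_ge0 ?sqr_ge0.
rewrite integral_indic//.
have -> : (K * M) ^+ 2 * (16 * (4 * B ^+ 2)) * (a ^+ 2 / 4) ^+ k =
  ((K * M) ^+ 2 * (a ^+ 2) ^+ k) * (((2 * 2^-1 ^+ k) *+ 2 * ((2 * 2^-1 ^+ k) *+ 2))
    * (B *+ 2 * (B *+ 2))).
  rewrite [(_ / 4) ^+ k]exprMn (_ : 4^-1 = 2^-1 ^+ 2 :> R); last by field.
  have -> : (2^-1 ^+ 2) ^+ k = (2^-1 ^+ k) ^+ 2 :> R by rewrite -!exprM mulnC.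
  by ring.
rewrite [leRHS]EFinM lee_wpmul2l//.
  by rewrite lee_fin mulr_ge0 ?sqr_ge0// exprn_ge0 ?sqr_ge0.
have h0 : (0 : R) <= 2 * 2^-1 ^+ k by rewrite mulr_ge0// exprn_ge0.
rewrite -(lebesgue_measure4_box ((0, 0), (0, 0)) h0 B0).
apply: le_measure; rewrite ?inE; [exact: measurableI|exact: mA|exact: subIsetl].
Qed.

End Integrability.

(** * The Bergman space through the squared norm *)

Section BergmanSpace.
Import Normc.
Local Open Scope complex_scope.
Context {R : realType}.
Implicit Types (mu c : R) (f g : C2 R -> C1 R).

(** The square of [L2norm]: comparison and splitting are simpler before the root is taken, and
    [L2norm_lt] translates back. *)
Definition worm_energy mu f : \bar R :=
  (\int[lebesgue_measure4]_(p in @to_C2 R @^-1` truncated_worm mu)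
      (normc (f (to_C2 p)) ^+ 2)%:E)%E.

Lemma worm_energy_ge0 mu f : (0 <= worm_energy mu f)%E.
Proof. by apply: integral_ge0 => p _; rewrite lee_fin sqr_ge0. Qed.

Lemma lt_poweR_half (x : \bar R) (e : R) : (0 <= x)%E -> 0 < e ->
  (x `^ 2^-1 < e%:E)%E = (x < (e ^+ 2)%:E)%E.
Proof.
case: x => [r| |]//= r0 e0.
  rewrite !lte_fin powR12_sqrt; last by rewrite -lee_fin.
  rewrite -[in LHS](@ltr_pXn2r _ 2) ?nnegrE ?sqrtr_ge0 ?(ltW e0)//.
  by rewrite sqr_sqrtr// -lee_fin.
by rewrite invr_eq0 pnatr_eq0 /= !ltNge !leey.
Qed.

Lemma L2norm_lt mu f (e : R) : 0 < e ->
  (L2norm (truncated_worm mu) f < e%:E)%E = (worm_energy mu f < (e ^+ 2)%:E)%E.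
Proof. by move=> e0; rewrite -lt_poweR_half// worm_energy_ge0. Qed.

Lemma L2norm_fin mu f : (L2norm (truncated_worm mu) f < +oo)%E =
  (worm_energy mu f < +oo)%E.
Proof.
by apply/idP/idP => [|/poweR_lty]; [apply: lty_poweRy; rewrite invr_eq0|exact].
Qed.

Definition worm_continuous mu f :=
  forall z, truncated_worm mu z -> {for z, continuous f}.

Lemma holomorphic_continuous mu f : holomorphic_on (truncated_worm mu) f ->
  worm_continuous mu f.
Proof. by move=> hf z /hf; exact: differentiable_continuous. Qed.

Lemma measurable_worm mu : measurable (@to_C2 R @^-1` truncated_worm mu).
Proof. exact: measurable_preimage_open (@near_worm R mu). Qed.

Lemma measurable_energy mu f : worm_continuous mu f ->
  measurable_fun (to_C2 @^-1` truncated_worm mu)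
    (fun p => (normc (f (to_C2 p)) ^+ 2)%:E).
Proof. exact: measurable_normc_sqr (@near_worm R mu). Qed.

Lemma le_worm_energy mu f g (K : R) : 0 <= K ->
  worm_continuous mu f -> worm_continuous mu g ->
  (forall z, truncated_worm mu z -> normc (f z) <= K * normc (g z)) ->
  (worm_energy mu f <= (K ^+ 2)%:E * worm_energy mu g)%E.
Proof.
move=> K0 cf cg fg; rewrite /worm_energy -ge0_integralZl//; last first.
- by rewrite lee_fin sqr_ge0.
- by move=> p _; rewrite lee_fin sqr_ge0.
- exact: measurable_energy.
- exact: measurable_worm.
apply: ge0_le_integral; first exact: measurable_worm.
- by move=> p _; rewrite lee_fin sqr_ge0.
- exact: measurable_energy.
- by apply: measurable_funeM; exact: measurable_energy.
move=> p Dp; rewrite -EFinM lee_fin -exprMn.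
by rewrite ler_pXn2r ?nnegrE ?normc_ge0 ?mulr_ge0 ?normc_ge0//; exact: fg.
Qed.

(** Pointwise [(y + t)^2 <= 2 y^2 + 2 t^2]. This replaces Minkowski's inequality, both for sums in
    the space and for the terms of an expansion. *)
Lemma worm_energyD mu f g : worm_continuous mu f -> worm_continuous mu g ->
  (worm_energy mu (f + g)%R <= 2%:E * worm_energy mu f + 2%:E * worm_energy mu g)%E.
Proof.
move=> cf cg.
have ce h : worm_continuous mu h -> worm_continuous mu h -> (2%:E * worm_energy mu h =
   \int[lebesgue_measure4]_(p in @to_C2 R @^-1` truncated_worm mu)
      (2%:E * (normc (h (to_C2 p)) ^+ 2)%:E))%E.
  move=> ch _; rewrite /worm_energy ge0_integralZl//.
  - exact: measurable_worm.
  - exact: measurable_energy.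
  - by move=> p _; rewrite lee_fin sqr_ge0.
rewrite !ce// -ge0_integralD; last first.
- by apply: measurable_funeM; exact: measurable_energy.
- by move=> p _; rewrite -EFinM lee_fin mulr_ge0// sqr_ge0.
- by apply: measurable_funeM; exact: measurable_energy.
- by move=> p _; rewrite -EFinM lee_fin mulr_ge0// sqr_ge0.
- exact: measurable_worm.
have cfg : worm_continuous mu (f + g).
  by move=> z Dz; apply: (@cvgD R[i] (C1 R)); [exact: cf|exact: cg].
apply: ge0_le_integral; first exact: measurable_worm.
- by move=> p _; rewrite lee_fin sqr_ge0.
- exact: measurable_energy.
- by apply: emeasurable_funD; apply: measurable_funeM; exact: measurable_energy.
move=> p Dp; rewrite -!EFinM -EFinD lee_fin.
have := ler_normcD (f (to_C2 p)) (g (to_C2 p)).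
have := normc_ge0 ((f (to_C2 p)) + (g (to_C2 p))).
rewrite (_ : (f + g) (to_C2 p) = f (to_C2 p) + g (to_C2 p))//.
move: (normc _) (normc (f _)) (normc (g _)) => x y t x0 xyt.
have : x ^+ 2 <= (y + t) ^+ 2 by rewrite ler_pXn2r ?nnegrE// (le_trans x0).
have := sqr_ge0 (y - t); nra.
Qed.

Lemma bergmanP mu f : bergman (truncated_worm mu) f <->
  holomorphic_on (truncated_worm mu) f /\ (worm_energy mu f < +oo)%E.
Proof. by rewrite -L2norm_fin. Qed.

Lemma bergmanD mu f g : bergman (truncated_worm mu) f ->
  bergman (truncated_worm mu) g -> bergman (truncated_worm mu) (f + g).
Proof.
move=> /bergmanP[hf ef] /bergmanP[hg eg]; apply/bergmanP; split.
  move=> z Dz; apply: (@differentiableD R[i] (C2 R) (C1 R)); [exact: hf|exact: hg].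
apply: le_lt_trans (worm_energyD (holomorphic_continuous hf) (holomorphic_continuous hg)) _.
by rewrite lte_add_pinfty// lte_mul_pinfty// ?lee_fin.
Qed.

Lemma bergmanZ mu f (k : R[i]) : bergman (truncated_worm mu) f ->
  bergman (truncated_worm mu) (k *: f).
Proof.
move=> /bergmanP[hf ef]; apply/bergmanP.
have hk : holomorphic_on (truncated_worm mu) (k *: f).
  by move=> z Dz; apply: (@differentiableZ R[i] (C2 R) (C1 R)); exact: hf.
split=> //; apply: (@le_lt_trans _ _ ((normc k ^+ 2)%:E * worm_energy mu f)%E).
  apply: le_worm_energy; first exact: normc_ge0.
  - exact: holomorphic_continuous.
  - exact: holomorphic_continuous.
  by move=> z _; rewrite -normcM.
by rewrite lte_mul_pinfty// lee_fin sqr_ge0.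
Qed.

Lemma bergman_cst0 mu : bergman (truncated_worm mu) (0 : C2 R -> C1 R).
Proof.
apply/bergmanP; split; first by move=> z _; exact: differentiable_cst.
rewrite /worm_energy integral0_eq// => p _.
by rewrite (_ : (0 : C2 R -> C1 R) _ = 0)// normc0 expr0n.
Qed.

Lemma bergman_sum mu n (f : 'I_n -> C2 R -> C1 R) :
  (forall i, bergman (truncated_worm mu) (f i)) ->
  bergman (truncated_worm mu) (\sum_(i < n) f i).
Proof.
move=> bf; apply: (@big_ind _ (bergman (truncated_worm mu))) => [|x y|i _].
- exact: bergman_cst0.
- exact: bergmanD.
- exact: bf.
Qed.

Lemma bergman_worm_G mu c (j : int) : -1 < c ->
  bergman (truncated_worm mu) (worm_G c j).
Proof.
move=> c1; apply/bergmanP.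
have hG : holomorphic_on (truncated_worm mu) (worm_G c j).
  by move=> z Dz; exact: differentiable_worm_G Dz.
split=> //; have [K K0 GK] := worm_G_bound mu c j.
exact: worm_L2_fin c1 (holomorphic_continuous hG) GK.
Qed.

Lemma worm_HE c0 nu l (j : int) :
  worm_H c0 nu l j = worm_G (c0 + nu * l%:R) j :> (C2 R -> C1 R).
Proof. by []. Qed.

End BergmanSpace.

(** * Uniform convergence of Euler's scheme for the quadratic fixed point *)

Section QuadraticIteration.
Import Normc.
Local Open Scope complex_scope.
Context {R : realType}.
Implicit Types (a s z w : R[i]) (h : R).

(* Euler's scheme for Q' = 1 - Q - a Q^2, whose attracting fixed point is
   2 / (1 + s) with s the square root of 1 + 4 a in the right half-plane. *)
Fixpoint qiter h a k : R[i] :=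
  if k is k'.+1 then
    let q := qiter h a k' in q + h%:C * (1 - q - a * q ^+ 2)
  else 1.

Fixpoint qiter_poly h (lam : R[i]) k : {poly R[i]} :=
  if k is k'.+1 then
    let q := qiter_poly h lam k' in q + h%:C *: (1 - q - lam *: ('X * q ^+ 2))
  else 1.

Lemma horner_qiter h lam u k : (qiter_poly h lam k).[u] = qiter h (lam * u) k.
Proof.
by elim: k => [|k /= <-]; rewrite !(hornerE, horner_exp) // mulrA.
Qed.

Lemma qiter_at0 h k : qiter h 0 k = 1.
Proof.
by elim: k => //= k ->; rewrite mul0r subr0 subrr mulr0 addr0.
Qed.

(** Cauchy-Schwarz, read off from the real part of [z] times the conjugate of [w]. *)
Lemma dot_le_normc z w :
  complex.Re z * complex.Re w + complex.Im z * complex.Im w <= normc z * normc w.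
Proof.
have -> : normc w = normc w^* by case: w => x y /=; rewrite sqrrN.
rewrite -normcM; apply: le_trans (Re_le_normc _); apply: le_trans (ler_norm _).
by case: z w => [x y] [x' y'] /=; rewrite mulrN opprK.
Qed.

(** The two moduli are those of the factors by which one Euler step multiplies the scaled distances
    [e] and [f] to the fixed points, with [E = (1 - s) e]. In the expanded square the term
    [- 2 h Re s] outweighs the terms of order [h^2], so the ratio of the factors contracts. *)
Lemma euler_factor_le (P B d h : R) (E s : R[i]) : 0 < h -> 0 <= B ->
  normc E <= P -> normc s <= B -> d <= complex.Re s -> 0 <= d ->
  h * P <= 4 -> h * (P * B / 2 + B ^+ 2) <= d ->
  normc (1 - (h / 4)%:C * E - h%:C * s) ^+ 2
    <= (1 - h * d / 4) * normc (1 - (h / 4)%:C * E) ^+ 2.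
Proof.
move=> h0 B0 EP sB ds d0 hP hd.
have X2 : normc (1 - (h / 4)%:C * E) <= 2.
  apply: (le_trans (ler_normcD _ _)); rewrite normc_opp normc1 normcM normc_real.
  rewrite gtr0_norm ?divr_gt0//.
  have : h * normc E <= h * P by rewrite ler_wpM2l// ltW.
  lra.
have X4 : normc (1 - (h / 4)%:C * E) ^+ 2 <= 4.
  by have := normc_ge0 (1 - (h / 4)%:C * E); nra.
have Es : complex.Re E * complex.Re s + complex.Im E * complex.Im s <= P * B.
  apply: (le_trans (dot_le_normc _ _)).
  by rewrite ler_pM ?normc_ge0.
have s2 : normc s ^+ 2 <= B ^+ 2 by rewrite ler_pXn2r ?nnegrE ?normc_ge0.
have : normc (1 - (h / 4)%:C * E - h%:C * s) ^+ 2 =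
  normc (1 - (h / 4)%:C * E) ^+ 2 - 2 * h * complex.Re s
  + h ^+ 2 / 2 * (complex.Re E * complex.Re s + complex.Im E * complex.Im s)
  + h ^+ 2 * normc s ^+ 2.
  by case: E s {EP sB ds X2 X4 Es s2} => [x y] [x' y']; rewrite !sqr_normcE /=; field.
move=> ->.
move: (normc (_ - _) ^+ 2) (complex.Re E * _ + _) (normc s ^+ 2) X4 Es s2 => X e t X4 Es s2.
have A : h ^+ 2 / 2 * e <= h ^+ 2 / 2 * (P * B).
  by rewrite ler_wpM2l ?divr_ge0 ?sqr_ge0.
have A' : h ^+ 2 * t <= h ^+ 2 * B ^+ 2 by rewrite ler_wpM2l ?sqr_ge0.
have A3 : h * (h * (P * B / 2 + B ^+ 2)) <= h * d by rewrite ler_wpM2l// ltW.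
have A4 : h * d <= h * complex.Re s by rewrite ler_wpM2l// ltW.
have A5 : h * d * X <= h * d * 4 by rewrite ler_wpM2l// mulr_ge0// ltW.
nra.
Qed.

(** The target [2 / (1 + s)] is the attracting fixed point. Since [h] and [k] depend on [d], [B] and
    [eta] only, one polynomial will serve the whole domain. *)
Lemma qiter_bound (d B eta : R) : 0 < d -> 0 < B -> 0 < eta ->
  exists h k, forall a s, s ^+ 2 = 1 + 4 * a -> d <= complex.Re s ->
    normc s <= B -> normc (qiter h a k) <= 2 / normc (1 + s) + eta.
Proof.
move=> d0 B0 eta0.
(* Bound for the initial squared ratio: [e 0 = 1 - s], [f 0 = 1 + s], and
   [|1 - s|^2 = |1 + s|^2 - 4 Re s]. *)
pose rho := 1 - 4 * d / (1 + B) ^+ 2.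
have rho1 : 0 < 1 - rho.
  by rewrite /rho opprB addrC subrK divr_gt0 ?mulr_gt0 ?exprn_gt0 ?addr_gt0.
(* [P] will bound [(1 + s) f] and [(1 - s) e] along the iteration; [4 B] comes from the identity
   [(1 + s) f - (1 - s) e = 4 s]. *)
have [P [P0 PE]] : exists P, 0 < P /\ P * (1 - rho) = 4 * B.
  exists (4 * B / (1 - rho)); split; first by rewrite divr_gt0// mulr_gt0.
  by rewrite divfK// gt_eqF.
have [N [N0 NE]] : exists N, 0 < N /\ N = P * B / 2 + B ^+ 2.
  eexists; split; last reflexivity.
  by rewrite addr_gt0 ?exprn_gt0// divr_gt0// mulr_gt0.
have [h [h0 hP hN]] : exists h, [/\ 0 < h, h * P <= 4 & h * N <= d].
  exists (Num.min (4 / P) (d / N)); split.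
  - by rewrite lt_min !divr_gt0.
  - by rewrite -ler_pdivlMr// ge_min lexx.
  - by rewrite -ler_pdivlMr// ge_min lexx orbT.
exists h.
(* For [B < d] no [s] satisfies the constraints; the case [d <= B] yields [0 <= r] for the
   contraction factor. *)
have [dB|dB] := ltP B d.
  exists 0%N => a s _ ds sB; exfalso.
  have := le_trans ds (le_trans (ler_norm _) (le_trans (Re_le_normc s) sB)).
  by rewrite leNgt dB.
pose r := 1 - h * d / 4.
have hB : h * B ^+ 2 <= d.
  apply: le_trans hN; rewrite ler_wpM2l ?(ltW h0)// NE lerDr.
  by rewrite divr_ge0// mulr_ge0// ltW.
have r1 : r < 1 by rewrite ltrBlDr ltrDl divr_gt0// mulr_gt0.
have r0 : 0 <= r.
  have hdd : h * d * d <= h * B ^+ 2 by rewrite -mulrA ler_wpM2l ?(ltW h0)//; nra.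
  have hd : h * d <= 1 by rewrite -(ler_pM2r d0) mul1r; lra.
  rewrite /r; lra.
have [k rk] : exists k, r ^+ k * P ^+ 2 <= eta ^+ 2.
  have /cvgrPdist_le H : (fun k => r ^+ k) @ \oo --> (0 : R).
    by apply: cvg_expr; rewrite ger0_norm.
  have e0 : 0 < eta ^+ 2 / P ^+ 2 by rewrite divr_gt0// exprn_gt0.
  have [k _ Hk] := H _ e0; exists k.
  have := Hk k (leqnn k); rewrite /= sub0r normrN ger0_norm ?exprn_ge0//.
  by rewrite ler_pdivlMr// exprn_gt0.
exists k => a s sa ds sB.
have aE : a = (s ^+ 2 - 1) / 4 by rewrite sa; field.
have s1 : 1 <= normc (1 + s).
  apply: le_trans (Re_le_normc _); apply: le_trans (ler_norm _).
  by case: s ds {sa sB aE} => x y /= ds; lra.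
have s1B : normc (1 + s) <= 1 + B.
  by apply: (le_trans (ler_normcD _ _)); rewrite normc1; lra.
have sr : normc (1 - s) ^+ 2 <= rho * normc (1 + s) ^+ 2.
  have E : normc (1 - s) ^+ 2 = normc (1 + s) ^+ 2 - 4 * complex.Re s.
    by case: s {sa sB aE ds s1 s1B} => x y; rewrite !sqr_normcE /=; ring.
  have s2 : normc (1 + s) ^+ 2 <= (1 + B) ^+ 2 by nra.
  have : 4 * d / (1 + B) ^+ 2 * normc (1 + s) ^+ 2 <= 4 * d.
    rewrite -mulrA ler_piMr ?mulr_ge0 ?(ltW d0)//.
    by rewrite mulrC ler_pdivrMr ?mul1r// exprn_gt0// addr_gt0.
  rewrite E /rho mulrBl mul1r; lra.
have rho0 : 0 <= rho.
  have := le_trans (sqr_ge0 _) sr; rewrite pmulr_lge0// exprn_gt0//; lra.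
(* e and f measure the distances to the attracting and to the repelling fixed
   point; e f = 4 (1 - q - a q^2), so one step multiplies each of them by a
   factor, and the ratio |e / f| contracts geometrically. *)
pose e n := 2 - (1 + s) * qiter h a n.
pose f n := 2 - (1 - s) * qiter h a n.
(* The ratio bound at index [n] already bounds the quantity entering the next factor, which lets the
   induction in [main] close. *)
have step n : normc (e n) ^+ 2 <= rho * normc (f n) ^+ 2 ->
    normc ((1 + s) * f n) <= P /\ normc ((1 - s) * e n) <= P.
  move=> ef.
  have EF : normc ((1 - s) * e n) <= rho * normc ((1 + s) * f n).
    rewrite -(@ler_pXn2r _ 2) ?nnegrE ?normc_ge0 ?mulr_ge0 ?normc_ge0//.
    rewrite !normcM !exprMn.
    apply: (le_trans (ler_pM (sqr_ge0 _) (sqr_ge0 _) sr ef)).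
    by rewrite le_eqVlt; apply/orP; left; apply/eqP; ring.
  have FE : normc ((1 + s) * f n) <= normc ((1 - s) * e n) + 4 * B.
    rewrite (_ : (1 + s) * f n = (1 - s) * e n + 4 * s); last by rewrite /e /f; ring.
    apply: (le_trans (ler_normcD _ _)); rewrite lerD2l normcM.
    have -> : (4 : R[i]) = (4 : R)%:C by rewrite rmorph_nat.
    by rewrite normc_real ger0_norm// ler_wpM2l.
  have FP : normc ((1 + s) * f n) <= P.
    by rewrite -(ler_pM2r rho1) PE mulrBr mulr1; lra.
  split=> //; apply: le_trans EF _; apply: le_trans FP.
  by rewrite ler_piMl ?normc_ge0//; lra.
have h4 : (h / 4)%:C = h%:C / 4 :> R[i] by rewrite rmorphM /= fmorphV rmorph_nat.
have main n : normc (e n) ^+ 2 <= r ^+ n * (rho * normc (f n) ^+ 2).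
  elim: n => [|n IH].
    have -> : e 0%N = 1 - s by rewrite /e [qiter _ _ _]/=; ring.
    have -> : f 0%N = 1 + s by rewrite /f [qiter _ _ _]/=; ring.
    by rewrite expr0 mul1r.
  have ef : normc (e n) ^+ 2 <= rho * normc (f n) ^+ 2.
    apply: (le_trans IH); rewrite ler_piMl ?(mulr_ge0 rho0 (sqr_ge0 _))//.
    by rewrite exprn_ile1// ltW.
  have [FP EP] := step _ ef.
  have eS : e n.+1 = e n * (1 - (h / 4)%:C * ((1 - s) * e n) - h%:C * s).
    by rewrite /e [qiter _ _ _.+1]/= aE h4; field.
  have fS : f n.+1 = f n * (1 - (h / 4)%:C * ((1 - s) * e n)).
    by rewrite /f /e [qiter _ _ _.+1]/= aE h4; field.
  rewrite eS fS !normcM !exprMn (exprS r n).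
  have := euler_factor_le h0 (ltW B0) EP sB ds (ltW d0) hP.
  rewrite -NE => /(_ hN); rewrite -/r => H.
  apply: (le_trans (ler_pM (sqr_ge0 _) (sqr_ge0 _) IH H)).
  by rewrite le_eqVlt; apply/orP; left; apply/eqP; ring.
have ef : normc (e k) ^+ 2 <= rho * normc (f k) ^+ 2.
  apply: (le_trans (main k)); rewrite ler_piMl ?(mulr_ge0 rho0 (sqr_ge0 _))//.
  by rewrite exprn_ile1// ltW.
have [FP _] := step _ ef.
have ek : normc (e k) <= eta.
  rewrite -(@ler_pXn2r _ 2) ?nnegrE ?normc_ge0 ?(ltW eta0)//.
  apply: (le_trans (main k)); apply: le_trans rk.
  rewrite ler_wpM2l ?exprn_ge0//.
  have fP : normc (f k) <= P.
    apply: le_trans FP; rewrite normcM ler_peMl ?normc_ge0//.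
  have f2 : normc (f k) ^+ 2 <= P ^+ 2 by rewrite ler_pXn2r ?nnegrE ?normc_ge0 ?(ltW P0).
  apply: le_trans f2; rewrite ler_piMl ?sqr_ge0//; lra.
have s0 : 0 < normc (1 + s) by lra.
(* Here [2 - e k] is [1 + s] times the iterate; division by [|1 + s| >= 1] does not enlarge
   [eta]. *)
have : normc ((1 + s) * qiter h a k) <= 2 + eta.
  rewrite (_ : _ * _ = 2 - e k); last by rewrite /e; ring.
  apply: (le_trans (ler_normcD _ _)); rewrite normc_opp.
  have -> : (2 : R[i]) = (2 : R)%:C by rewrite rmorph_nat.
  by rewrite normc_real ger0_norm// lerD2l.
rewrite normcM mulrC -ler_pdivlMr// mulrDl => /le_trans; apply.
by rewrite lerD2l ler_pdivrMr// ler_peMr// ltW.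
Qed.

End QuadraticIteration.

(** * The range of [worm_u], square roots over it, and the closure property *)

Section Closure.
Import Normc.
Local Open Scope complex_scope.
Context {R : realType}.
Implicit Types (mu c nu : R) (z : C2 R).

Definition worm_u nu z : R[i] := cexp (nu%:C * worm_L z).

Lemma sqrt_right_half (w : R[i]) : exists s, s ^+ 2 = w /\ 0 <= complex.Re s.
Proof.
have h := sqr_sqrtc w; have [s0|/ltW s0] := leP 0 (complex.Re (sqrtc w)).
  by exists (sqrtc w).
by exists (- sqrtc w); rewrite sqrrN; split=> //; case: (sqrtc w) s0 => x y /=; lra.
Qed.

Lemma normc_worm_u mu nu z : truncated_worm mu z ->
  normc (worm_u nu z) = normc (z.1 : R[i]) `^ nu.
Proof.
move=> Dz; rewrite normc_cexp /powR gt_eqF ?(z1_gt0 Dz)//; congr expR.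
by have := Re_worm_L z; case: (worm_L z) => x y /= ->; rewrite mul0r subr0.
Qed.

(* For [mu = pi / 2] the complement of the range of [worm_u] has a cusp at 0 along
   the negative half-line; the factor [normc z.1] measures its width. *)
Lemma worm_u_sector mu nu z : pi / 2 <= mu -> nu = pi / (2 * mu) ->
  truncated_worm mu z -> complex.Re (worm_u nu z) < 0 ->
  normc (z.1 : R[i]) / 2 * normc (worm_u nu z) <= `|complex.Im (worm_u nu z)|.
Proof.
move=> hmu hnu Dz; have pp := pi_gt0 R; have mu0 : 0 < mu by lra.
have nu0 : 0 < nu by rewrite hnu divr_gt0// mulr_gt0.
have numu : nu * mu = pi / 2 by rewrite hnu; field; rewrite gt_eqF.
have nu1 : nu <= 1 by rewrite hnu ler_pdivrMr ?mulr_gt0//; lra.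
have Rz := zeta_Re_gt0 Dz.
have e : worm_u nu z = (normc (worm_u nu z))%:C *
    (cos (nu * complex.Im (worm_L z)) +i* sin (nu * complex.Im (worm_L z))).
  rewrite normc_cexp /worm_u /cexp.
  case: (worm_L z) => x y /=; apply/eqP; rewrite eq_complex /=.
  by rewrite !mul0r !subr0 !addr0 !eqxx.
have u0 : 0 < normc (worm_u nu z) by rewrite normc_gt0 cexp_neq0.
set x := nu * complex.Im (worm_L z) in e *.
have z1c := z1_lt_cos Dz; have cb := carg_bound Rz.
set phi := `|carg (worm_zeta z)| in cb.
have phi0 : 0 <= phi := normr_ge0 _.
rewrite -cos_norm -/phi in z1c.
(* Uses [nu mu = pi / 2] for the worm angle and [nu <= 1] for the argument of zeta. *)
have xphi : `|x| <= phi + pi / 2.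
  rewrite normrM (gtr0_norm nu0) Im_worm_L.
  apply: (@le_trans _ _ (nu * (phi + mu))).
    rewrite ler_pM2l//; apply: (le_trans (ler_normD _ _)); rewrite lerD2l.
    by case: Dz => _ _ /ltW.
  by rewrite mulrDr numu lerD2r ler_piMl.
have cx : - sin phi <= cos x.
  rewrite -cosDpihalf -(cos_norm x) leNgt; apply/negP.
  have i1 : phi + pi / 2 \in `[0, pi] by rewrite in_itv /=; apply/andP; split; lra.
  have i2 : `|x| \in `[0, pi] by rewrite in_itv /= normr_ge0 /=; lra.
  by rewrite ltr_cos// ltNge xphi.
(* This is [|z1| < 2 cos phi] squared. Since [cos x] will be negative, [cx] gives
   [|cos x| <= sin phi], hence [(sin x)^2 >= (|z1| / 2)^2]. *)
have sphi : sin phi ^+ 2 <= 1 - (normc (z.1 : R[i]) / 2) ^+ 2.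
  have := cos2Dsin2 phi; have := z1_gt0 Dz; nra.
move: (normc (worm_u nu z)) e u0 => r -> r0.
move=> /=; rewrite !mul0r subr0 addr0 pmulr_rlt0// => cx0.
rewrite mulrC normrM (gtr0_norm r0) ler_pM2l//.
rewrite -(@ler_pXn2r _ 2) ?nnegrE ?divr_ge0 ?normc_ge0//.
rewrite real_normK ?num_real//.
have := cos2Dsin2 x; nra.
Qed.

(** The values [1 + 4 lam u] stay uniformly away from the negative half-line. If their real part is
    at least 1/2, so is [Re s]. Otherwise [|u| >= 1 / (8 lam)] keeps [|z1|] above [r0], away from
    the cusp, and [worm_u_sector] bounds the imaginary part from below. *)
Lemma worm_sqrt mu nu lam : pi / 2 <= mu -> nu = pi / (2 * mu) -> 0 < lam ->
  exists d B, [/\ 0 < d, 0 < B & forall z, truncated_worm mu z ->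
    exists s : R[i], [/\ s ^+ 2 = 1 + 4 * (lam%:C * worm_u nu z),
      d <= complex.Re s & normc s <= B]].
Proof.
move=> hmu hnu lam0; have pp := pi_gt0 R; have mu0 : 0 < mu by lra.
have nu0 : 0 < nu by rewrite hnu divr_gt0// mulr_gt0.
have nu1 : nu <= 1 by rewrite hnu ler_pdivrMr ?mulr_gt0//; lra.
(* [r0] is the modulus of [z1] at which [|u| = |z1|^nu] equals [1 / (8 lam)], and [B] comes from
   [|u| <= 2]. Near the half-line [2 Re s |Im s| >= r0 / 4] with [|Im s| <= B], whence
   [r0 / (8 B)]. *)
pose B := 1 + 8 * lam; pose r0 := (8 * lam)^-1 `^ nu^-1.
have B0 : 0 < B by rewrite /B; lra.
have r00 : 0 < r0 by rewrite powR_gt0// invr_gt0 mulr_gt0.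
have d0 : 0 < r0 / (8 * B) by rewrite divr_gt0// mulr_gt0.
exists (Num.min 2^-1 (r0 / (8 * B))), B; split=> //.
  by rewrite lt_min invr_gt0 ltr0n d0.
move=> z Dz; have [s [s2 s0]] := sqrt_right_half (1 + 4 * (lam%:C * worm_u nu z)).
exists s; have z10 := z1_gt0 Dz.
have z1_2 := z1_lt2 Dz.
have nuz := normc_worm_u nu Dz.
have u2 : normc (worm_u nu z) <= 2.
  rewrite nuz; apply: (@le_trans _ _ (2 `^ nu)).
    by rewrite ge0_ler_powR ?nnegrE ?(ltW z10) ?(ltW nu0) ?(ltW z1_2).
  by rewrite -[leRHS]powRr1// ler_powR// ler1n.
have sB : normc s <= B.
  have : normc s ^+ 2 <= B.
    rewrite -normcX s2; apply: (le_trans (ler_normcD _ _)); rewrite normc1 lerD2l.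
    have -> : (4 : R[i]) = (4 : R)%:C by rewrite rmorph_nat.
    rewrite !normcM !normc_real !ger0_norm ?(ltW lam0)//.
    by have := ler_wpM2l (ltW lam0) u2; lra.
  have : 1 <= B by rewrite /B; lra.
  have := normc_ge0 s; nra.
split=> //.
have us := worm_u_sector hmu hnu Dz.
have E4 : (4 : R[i]) = (4 : R)%:C by rewrite rmorph_nat.
have reE : complex.Re s ^+ 2 - complex.Im s ^+ 2 =
    1 + 4 * (lam * complex.Re (worm_u nu z)).
  move: s2; rewrite E4; case: (s) (worm_u nu z) => x y [a b] /(congr1 (@complex.Re R)) /=.
  by rewrite !mul0r !subr0 => <-; ring.
have imE : 2 * (complex.Re s * complex.Im s) = 4 * (lam * complex.Im (worm_u nu z)).
  move: s2; rewrite E4; case: (s) (worm_u nu z) => x y [a b] /(congr1 (@complex.Im R)) /=.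
  by rewrite !mul0r !addr0 add0r => <-; ring.
have [h|h] := leP (2^-1) (1 + 4 * (lam * complex.Re (worm_u nu z))).
  rewrite ge_min; apply/orP; left.
  by have := sqr_ge0 (complex.Im s); nra.
have re0 : complex.Re (worm_u nu z) < 0.
  by rewrite -(pmulr_rlt0 _ lam0); lra.
have := us re0 => {}us.
have ur : (8 * lam)^-1 <= normc (worm_u nu z).
  rewrite -div1r ler_pdivrMr ?mulr_gt0//.
  have : - complex.Re (worm_u nu z) <= normc (worm_u nu z).
    apply: le_trans (Re_le_normc _); rewrite -normrN; exact: ler_norm.
  by move=> /(ler_wpM2l (ltW lam0)); lra.
have r0z : r0 <= normc (z.1 : R[i]).
  have -> : normc (z.1 : R[i]) = normc (worm_u nu z) `^ nu^-1.
    by rewrite nuz -powRrM mulfV ?gt_eqF// powRr1// ltW.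
  rewrite ge0_ler_powR ?nnegrE ?normc_ge0 ?invr_ge0 ?(ltW nu0)//.
  by rewrite mulr_ge0// ltW.
rewrite ge_min; apply/orP; right.
rewrite ler_pdivrMr ?mulr_gt0//.
have Ims := Im_le_normc s.
have i1 : r0 / 2 * (8 * lam)^-1 <= `|complex.Im (worm_u nu z)|.
  apply: le_trans us; rewrite ler_pM ?invr_ge0 ?divr_ge0 ?mulr_ge0 ?(ltW r00) ?(ltW lam0)//.
  by rewrite ler_pM2r.
have i2 : r0 / 4 <= 4 * (lam * `|complex.Im (worm_u nu z)|).
  have : lam * (r0 / 2 * (8 * lam)^-1) <= lam * `|complex.Im (worm_u nu z)|.
    by rewrite ler_wpM2l// ltW.
  have -> : lam * (r0 / 2 * (8 * lam)^-1) = r0 / 16 by field; rewrite gt_eqF.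
  lra.
move: (complex.Im (worm_u nu z)) imE i1 i2 {us} => v imE i1 i2.
have : `|2 * (complex.Re s * complex.Im s)| = 4 * (lam * `|v|).
  by rewrite imE !normrM (gtr0_norm lam0) ger0_norm.
rewrite !normrM ger0_norm// (ger0_norm s0) => i3.
have : complex.Re s * `|complex.Im s| <= complex.Re s * B.
  by rewrite ler_wpM2l// (le_trans Ims).
lra.
Qed.

(** Taken with [lam = n + 1] and accuracy [1 / (n + 1)]. The uniform bound is
    [2 / |1 + s| + 1 <= 3], and pointwise [|s|^2 >= 4 (n + 1) |u| - 1] tends to infinity because [u]
    never vanishes. *)
Lemma worm_poly mu nu : pi / 2 <= mu -> nu = pi / (2 * mu) ->
  exists P : nat -> {poly R[i]}, [/\ forall n, (P n).[0] = 1,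
    forall n z, truncated_worm mu z -> normc (P n).[worm_u nu z] <= 3 &
    forall z, truncated_worm mu z ->
      normc (P n).[worm_u nu z] @[n --> \oo] --> 0].
Proof.
move=> hmu hnu.
have ex n : exists P : {poly R[i]}, P.[0] = 1 /\ forall z, truncated_worm mu z ->
    exists s : R[i], [/\ s ^+ 2 = 1 + 4 * (n.+1%:R%:C * worm_u nu z),
      0 < complex.Re s & normc P.[worm_u nu z] <= 2 / normc (1 + s) + n.+1%:R^-1].
  have n0 : 0 < n.+1%:R :> R by rewrite ltr0n.
  have [d [B [d0 B0 H]]] := worm_sqrt hmu hnu n0.
  have ni : 0 < n.+1%:R^-1 :> R by rewrite invr_gt0.
  have [h [k hk]] := qiter_bound d0 B0 ni.
  exists (qiter_poly h n.+1%:R%:C k); rewrite horner_qiter mulr0 qiter_at0.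
  split=> // z Dz; have [s [s2 sd sB]] := H z Dz.
  exists s; split=> //; first exact: lt_le_trans d0 sd.
  by rewrite horner_qiter; exact: hk.
have [P HP] := choice ex.
have ge_s (s : R[i]) : 0 < complex.Re s -> 1 <= normc (1 + s) /\
    normc s ^+ 2 <= normc (1 + s) ^+ 2.
  move=> x0; split; last by case: s x0 => x y x0; rewrite !sqr_normcE /= in x0 *; nra.
  apply: le_trans (Re_le_normc _); apply: le_trans (ler_norm _).
  by case: s x0 => x y /=; lra.
exists P; split=> [n|n z Dz|z Dz]; first by have [] := HP n.
  have [_ /(_ z Dz)[s [_ s0 /le_trans]]] := HP n; apply.
  have [s1 _] := ge_s _ s0.
  have : n.+1%:R^-1 <= 1 :> R by rewrite invf_le1 ?ler1n// ltr0n.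
  have : 2 / normc (1 + s) <= 2 by rewrite ler_pdivrMr; lra.
  by move=> a b; apply: (le_trans (lerD a b)); lra.
apply/cvgrPdist_le => e e0.
have u0 : 0 < normc (worm_u nu z) by rewrite normc_gt0 cexp_neq0.
(* The second entry forces [|s| >= 4 / e], so that each of the two summands is at most [e / 2]. *)
have e1 : 0 < Num.min (e / 2) (4 * normc (worm_u nu z) / (1 + 16 / e ^+ 2)).
  rewrite lt_min !divr_gt0 ?mulr_gt0// addr_gt0// divr_gt0// exprn_gt0//.
have [N _ HN] := near_infty_natSinv_lt (PosNum e1).
exists N => // n /= Nn.
rewrite sub0r normrN ger0_norm ?normc_ge0//.
have [_ /(_ z Dz)[s [s2 s0 /le_trans]]] := HP n; apply.
have [s1 ss] := ge_s _ s0.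
have : n.+1%:R^-1 < Num.min (e / 2) (4 * normc (worm_u nu z) / (1 + 16 / e ^+ 2)).
  exact: HN n Nn.
rewrite lt_min => /andP[n1 n2].
have n0 : 0 < n.+1%:R :> R by rewrite ltr0n.
have sn : 4 * (n.+1%:R * normc (worm_u nu z)) - 1 <= normc s ^+ 2.
  rewrite -normcX s2.
  have := ler_normcD (1 + 4 * (n.+1%:R%:C * worm_u nu z)) (- 1).
  rewrite normc_opp normc1 addrAC subrr add0r.
  have -> : (4 : R[i]) = (4 : R)%:C by rewrite rmorph_nat.
  rewrite !normcM !normc_real !ger0_norm ?(ltW n0)//; lra.
have big : 16 / e ^+ 2 <= normc s ^+ 2.
  apply: le_trans sn; move: (normc (worm_u nu z)) n2 => t n2.
  move: n2; rewrite ltr_pdivlMr; last by rewrite addr_gt0// divr_gt0// exprn_gt0.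
  by rewrite mulrC ltr_pdivrMr//; move: (n.+1%:R) (16 / e ^+ 2) => x y; lra.
have s4 : 4 / e <= normc (1 + s).
  rewrite -(@ler_pXn2r _ 2) ?nnegrE ?normc_ge0 ?divr_ge0 ?(ltW e0)//.
  apply: le_trans ss; apply: le_trans big.
  by rewrite exprMn exprVn -natrX.
have : 2 / normc (1 + s) <= e / 2.
  rewrite ler_pdivrMr; last lra.
  by move: s4; rewrite ler_pdivrMr//; lra.
by move=> a; apply: (le_trans (lerD a (ltW n1))); rewrite -splitr.
Qed.

Lemma worm_GM nu c l (j : int) z :
  worm_G (c + nu * l%:R) j z = worm_u nu z ^+ l * worm_G c j z.
Proof.
rewrite /worm_G mulrA; congr (_ * _); rewrite /worm_E /worm_u -cexpMn -cexpD.
congr cexp; rewrite -mulrnAl -mulrDl; congr (_ * _).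
rewrite -[nu%:C *+ l]mulr_natr -(rmorph_nat (real_complex R)) -rmorphM.
by apply/eqP; rewrite eq_complex /= add0r addrC !eqxx.
Qed.

Lemma worm_G_closure mu c nu (j : int) : pi / 2 <= mu -> nu = pi / (2 * mu) ->
  -1 < c ->
  norm_closure (bergman (truncated_worm mu)) (L2norm (truncated_worm mu))
    (linspan [set worm_G (c + nu * l%:R) j | l in [set l : nat | (1 <= l)%N]]) (worm_G c j : C2 R -> C1 R).
Proof.
move=> hmu hnu c1; have pp := pi_gt0 R; have mu0 : 0 < mu by lra.
have nu0 : 0 < nu by rewrite hnu divr_gt0// mulr_gt0.
have bG l : bergman (truncated_worm mu) (worm_G (c + nu * l%:R) j).
  by apply: bergman_worm_G; rewrite (lt_le_trans c1)// lerDl mulr_ge0// ltW.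
split; first exact: bergman_worm_G.
move=> e e0; have [P [P1 P3 P0]] := worm_poly hmu hnu.
pose m n := (size (P n)).-1.
(* The coefficients of positive degree with reversed sign: as the constant coefficient is 1,
   subtracting [g n] leaves the function multiplied by the value of [P n] at [u]. *)
pose g n := \sum_(l < m n) (- (P n)`_l.+1) *: (worm_G (c + nu * l.+1%:R) j : C2 R -> C1 R).
have bg n : bergman (truncated_worm mu) (g n).
  by apply: bergman_sum => i; exact: bergmanZ.
have Pg n z : ((worm_G c j : C2 R -> C1 R) - g n) z = (P n).[worm_u nu z] * worm_G c j z.
  rewrite (_ : (_ - g n) z = worm_G c j z - g n z)//.
  rewrite /g fct_sumE.
  have Pn0 : P n != 0 by apply: contra_eq_neq (P1 n) => ->; rewrite horner0 eq_sym oner_eq0.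
  rewrite horner_coef -(prednK (n := size (P n))) ?size_poly_gt0//.
  rewrite big_ord_recl /= expr0 mulr1.
  have -> : (P n)`_0 = 1 by rewrite -(P1 n) horner_coef0.
  rewrite mulrDl mul1r; congr (_ + _); rewrite -sumrN mulr_suml.
  apply: eq_bigr => i _.
  rewrite -[(_ *: _) z]/(- (P n)`_i.+1 * worm_G (c + nu * i.+1%:R) j z).
  by rewrite worm_GM mulNr opprK mulrA.
pose D4 := @to_C2 R @^-1` truncated_worm mu.
have bd n : bergman (truncated_worm mu) ((worm_G c j : C2 R -> C1 R) - g n).
  rewrite -[- g n]scaleN1r; apply: bergmanD; last exact: bergmanZ.
  exact: bergman_worm_G.
have cd n := holomorphic_continuous (bd n).1.
have bG0 : bergman (truncated_worm mu) (worm_G c j : C2 R -> C1 R) by exact: bergman_worm_G.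
have cG := holomorphic_continuous bG0.1.
(* The majorant carries 9, the square of the uniform bound 3 on the polynomials. *)
have [] := @dominated_convergence _ _ _ lebesgue_measure4 D4 (measurable_worm mu)
  (fun n p => (normc (((worm_G c j : C2 R -> C1 R) - g n) (to_C2 p)) ^+ 2)%:E)
  (cst 0%E) (fun p => (9%:E * (normc (worm_G c j (to_C2 p)) ^+ 2)%:E)%E).
- by move=> n; exact: (measurable_energy (cd n)).
- exact: measurable_cst.
- apply: aeW => p Dp; rewrite /=.
  have H : (normc (P n).[worm_u nu (to_C2 p)] * normc (worm_G c j (to_C2 p))) ^+ 2
     @[n --> \oo] --> (0 * normc (worm_G c j (to_C2 p))) ^+ 2.
    apply: (@continuous_cvg _ _ _ _ _ _ (fun x : R => x ^+ 2)).
      exact: exprn_continuous.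
    by apply: cvgM; [exact: P0|exact: cvg_cst].
  rewrite mul0r expr0n /= in H.
  apply/cvg_EFin; first by apply: nearW.
  apply: cvg_trans H; apply: near_eq_cvg; apply: nearW => n /=.
  by rewrite Pg -normcM.
- apply/integrableP; split.
    by apply: measurable_funeM; exact: measurable_energy.
  under eq_integral do rewrite gee0_abs ?mule_ge0 ?lee_fin ?sqr_ge0//.
  rewrite ge0_integralZl//; last 3 first.
  - exact: measurable_worm.
  - exact: measurable_energy.
  - by move=> p _; rewrite lee_fin sqr_ge0.
  by rewrite lte_mul_pinfty//; case: ((@bergmanP R _ _).1 bG0).
- apply: aeW => p n Dp; rewrite Pg abse_EFin ger0_norm ?sqr_ge0// -EFinM lee_fin.
  rewrite [normc (_ * worm_G _ _ _)]normcM exprMn.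
  rewrite ler_wpM2r ?sqr_ge0//.
  have := P3 n _ Dp; have := normc_ge0 (P n).[worm_u nu (to_C2 p)]; nra.
move=> _ _; rewrite integral0 => /fine_cvgP[fin cvg0].
have e2 : 0 < e ^+ 2 by rewrite exprn_gt0.
(* An infinite energy would have [fine] value 0, so eventual finiteness is extracted along with the
   limit. *)
have [n1 _ H1] := fin; have /cvgrPdist_lt/(_ _ e2)[n2 _ H2] := cvg0.
pose n := maxn n1 n2; exists (g n); split; first exact: bg.
  exists (m n), (fun l => - (P n)`_l.+1), (fun l => worm_G (c + nu * l.+1%:R) j : C2 R -> C1 R).
  by split=> // i; exists i.+1.
rewrite L2norm_lt// -[worm_energy _ _]fineK; last exact: H1 (leq_maxl _ _).
rewrite lte_fin; apply: le_lt_trans (ler_norm _) _.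
by have := H2 n (leq_maxr _ _); rewrite /= sub0r normrN.
Qed.

End Closure.

(** * From norm convergence to pointwise convergence, and series lemmas *)

Section NonBasis.
Import Normc.
Local Open Scope complex_scope.
Context {R : realType}.
Local Notation mR := (measurableTypeR R).
Local Notation R4 := ((mR * mR) * (mR * mR))%type.
Implicit Types (mu c nu : R) (z : C2 R) (f : C2 R -> C1 R).

Lemma worm_energy_ge_box mu f (p : R4) (d k : R) : 0 <= d -> 0 <= k ->
  worm_continuous mu f ->
  box p d d `<=` @to_C2 R @^-1` [set z | truncated_worm mu z /\ k <= normc (f z)] ->
  ((k ^+ 2 * (16 * d ^+ 4))%:E <= worm_energy mu f)%E.
Proof.
move=> d0 k0 cf sub.
have mb : measurable (box p d d) := measurable_box p d d.
have subD : box p d d `<=` @to_C2 R @^-1` truncated_worm mu by move=> q /sub [].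
apply: (@le_trans _ _ (\int[lebesgue_measure4]_(q in box p d d)
   (normc (f (to_C2 q)) ^+ 2)%:E)%E); last first.
  apply: ge0_subset_integral => //; first exact: measurable_worm.
    exact: measurable_energy.
  by move=> q _; rewrite lee_fin sqr_ge0.
apply: (@le_trans _ _ (\int[lebesgue_measure4]_(q in box p d d) (cst (k ^+ 2)%:E q))%E).
  rewrite integral_cst// lebesgue_measure4_box// -EFinM lee_fin.
  by rewrite le_eqVlt; apply/orP; left; apply/eqP; ring.
apply: ge0_le_integral => //.
- by move=> q _; rewrite lee_fin sqr_ge0.
- exact: measurable_funS (measurable_worm mu) subD (measurable_energy cf).
- by move=> q /sub[_ kf]; rewrite lee_fin ler_pXn2r ?nnegrE ?normc_ge0.
Qed.

Lemma to_C2_surj z : exists p : R4, to_C2 p = z.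
Proof. by case: z => [[a b] [c d]]; exists ((a, b), (c, d)). Qed.

Lemma near_box z (A : set (C2 R)) : (\forall w \near z, A w) ->
  exists p d, 0 < d /\ box p d d `<=` @to_C2 R @^-1` A.
Proof.
have [p pz] := to_C2_surj z; rewrite -pz => /nbhs_box[d d0 H].
by exists p, d.
Qed.

(** A gap [|f - F N| > e / 2] at [z] would persist on a box, on which the uniform Cauchy estimate
    keeps [|f - F n| >= e / 4] for all [n >= N]; the energy of [f - F n] could then not tend to
    0. *)
Lemma L2_cvg_pointwise mu (F : nat -> C2 R -> C1 R) f z :
  worm_continuous mu f -> (forall n, worm_continuous mu (F n)) ->
  (forall e, 0 < e -> exists N, forall n, (N <= n)%N ->
     (worm_energy mu (f - F n)%R < e%:E)%E) ->
  truncated_worm mu z ->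
  (forall e, 0 < e -> exists N, \forall y \near z, forall n, (N <= n)%N ->
     normc (F n y - F N y) <= e) ->
  forall e, 0 < e -> exists N, forall n, (N <= n)%N -> normc (f z - F n z) <= e.
Proof.
move=> cf cF L2 Dz uc e e0; have e4 : 0 < e / 4 by rewrite divr_gt0.
have [N HN] := uc _ e4; exists N.
have cfF n : worm_continuous mu (f - F n).
  by move=> y Dy; apply: (@cvgB R[i] (C1 R)); [exact: cf|exact: cF].
have fN : normc (f z - F N z) <= e / 2.
  rewrite leNgt; apply/negP => H.
  have H' : \forall y \near z, e / 2 < normc (f y - F N y).
    exact: cvgr_gt _ (cvg_normc (cfF N z Dz)) _ H.
  have [p [d [d0 sub]]] := near_box (filterI (near_worm Dz) (filterI HN H')).
  have k0 : 0 < (e / 4) ^+ 2 * (16 * d ^+ 4) by rewrite mulr_gt0 ?exprn_gt0// mulr_gt0 ?exprn_gt0.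
  have [N' HN'] := L2 _ k0; have := HN' (maxn N N') (leq_maxr _ _).
  rewrite ltNge => /negP; apply.
  apply: worm_energy_ge_box (ltW d0) (ltW e4) (cfF _) _ => q /sub[Dq [Hq1 Hq2]].
  split=> //; have := Hq1 _ (leq_maxl N N'); move: Hq2.
  set n := maxn N N'; set y := to_C2 q => Hq2 Hq1'.
  have := ler_normcD (f y - F n y) (F n y - F N y).
  rewrite addrA subrK => H3.
  rewrite (_ : (f - F n) y = f y - F n y)//; lra.
move=> n Nn; have := nbhs_singleton HN n Nn => Hn.
have := ler_normcD (f z - F N z) (F N z - F n z).
rewrite addrA subrK [normc (F N z - _)]normcBC => H3.
lra.
Qed.

Lemma sum_inj_le (I : finType) (n : nat) (h : 'I_n -> I) (G : I -> R) :
  injective h -> (forall i, 0 <= G i) -> \sum_(k < n) G (h k) <= \sum_i G i.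
Proof.
move=> hI G0.
have -> : \sum_(k < n) G (h k) = \sum_(i in [set h k | k : 'I_n]) G i.
  by rewrite big_imset /=; [apply: eq_bigl => k; rewrite inE|move=> ? ? _ _ /hI].
by rewrite [leRHS](bigID (mem [set h k | k : 'I_n])) /= lerDl sumr_ge0.
Qed.

Lemma geometric_sum_inj (e : nat -> nat * int) (x y : R) : injective e ->
  0 <= x < 1 -> 0 <= y < 1 ->
  exists S, forall n, \sum_(k < n) x ^+ (e k).1 * y ^+ absz ((e k).2 + 1)%R <= S.
Proof.
move=> eI x1 y1; exists ((1 - x)^-1 * ((1 - y)^-1 * 2)) => n.
pose N := \max_(k < n) ((e k).1 + absz ((e k).2 + 1)%R)%N.
have eN (k : 'I_n) : ((e k).1 + absz ((e k).2 + 1)%R <= N)%N.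
  by rewrite /N (bigD1 k)//= leq_maxl.
pose h (k : 'I_n) : 'I_N.+1 * ('I_N.+1 * bool) :=
  (inord (e k).1, (inord (absz ((e k).2 + 1)%R), ((e k).2 + 1 < 0)%R)).
have l1 (k : 'I_n) : ((e k).1 < N.+1)%N by rewrite ltnS (leq_trans _ (eN k))// leq_addr.
have l2 (k : 'I_n) : (absz ((e k).2 + 1)%R < N.+1)%N.
  by rewrite ltnS (leq_trans _ (eN k))// leq_addl.
have hI : injective h.
  move=> k k' [/(congr1 val)]; rewrite /= !inordK// => E1 /(congr1 val).
  rewrite /= !inordK// => E2 E3.
  apply/val_inj/eI; rewrite [LHS]surjective_pairing [RHS]surjective_pairing E1.
  congr pair; apply: (addIr 1).
  by rewrite [LHS]intEsign [RHS]intEsign E2 E3.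
pose G (i : 'I_N.+1 * ('I_N.+1 * bool)) := x ^+ i.1 * y ^+ i.2.1.
have /andP[x0 _] := x1; have /andP[y0 _] := y1.
rewrite (eq_bigr (fun k => G (h k))); last by move=> k _; rewrite /G /= !inordK.
apply: (le_trans (sum_inj_le hI _)) => [i|]; first by rewrite mulr_ge0// exprn_ge0.
rewrite -(pair_bigA _ (fun (i : 'I_N.+1) (j : 'I_N.+1 * bool) => x ^+ i * y ^+ j.1)) /=.
under eq_bigr => i _ do rewrite -mulr_sumr -(pair_bigA _ (fun (j : 'I_N.+1) (b : bool) => y ^+ j)) /=.
rewrite -mulr_suml ler_pM ?sumr_ge0//.
- by move=> i _; rewrite exprn_ge0.
- by move=> i _; rewrite sumr_ge0// => j _; rewrite exprn_ge0.
- by have := geometric_sum_le N.+1 x1; rewrite big_mkord.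
under eq_bigr => i _ do rewrite sumr_const card_bool -mulr_natr.
rewrite -mulr_suml ler_pM2r//.
by have := geometric_sum_le N.+1 y1; rewrite big_mkord.
Qed.

Lemma bounded_sum_cauchy (A : nat -> R) (S : R) : (forall k, 0 <= A k) ->
  (forall n, \sum_(k < n) A k <= S) ->
  forall e, 0 < e -> exists N, forall n, (N <= n)%N ->
    \sum_(N <= k < n) A k <= e.
Proof.
move=> A0 AS e e0; pose T n := \sum_(0 <= k < n) A k.
have Tnd : nondecreasing_seq T.
  move=> m n mn; rewrite /T (big_cat_nat (leq0n m) mn)/= lerDl.
  by rewrite sumr_ge0.
have Tub : has_ubound (range T).
  by exists S => _ [n _ <-]; rewrite /T big_mkord.
have Tc := nondecreasing_is_cvgn Tnd Tub.
have /cvgrPdist_lt/(_ _ e0)[N _ HN] : T @ \oo --> limn T by [].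
exists N => n Nn.
have h1 := HN N (leqnn _).
have h2 := nondecreasing_cvgn_le Tnd Tc n.
have -> : \sum_(N <= k < n) A k = T n - T N.
  by rewrite /T (big_cat_nat (leq0n N) Nn)/= addrAC subrr add0r.
move: h1; rewrite /= ltr_norml => /andP[_]; lra.
Qed.

(** Used with [s1], [s2] near partial sums at two points and [s0] their common constant term:
    comparing the values [y] and [y / 2] eliminates the unknown [s0]. *)
Lemma dist_halves (y k1 k2 d : R) (s0 s1 s2 : R[i]) :
  normc (s1 - s0) <= k1 -> normc (s2 - s0) <= k2 ->
  normc (y%:C - s1) <= d -> normc ((y / 2)%:C - s2) <= d ->
  y / 2 <= (d + k1) + (k2 + d).
Proof.
move=> d1 d2 h1 h2; apply: (le_trans (ler_norm _)); rewrite -normc_real.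
have -> : (y / 2)%:C = (y%:C - s1) + (s1 - s0) - ((s2 - s0) + ((y / 2)%:C - s2)).
  have {1}-> : (y / 2)%:C = y%:C - (y / 2)%:C :> R[i].
    by rewrite -rmorphB; congr (_%:C); field.
  by ring.
apply: (le_trans (ler_normcD _ _)); rewrite normc_opp.
by apply: lerD; apply: (le_trans (ler_normcD _ _)); exact: lerD.
Qed.

(** An absolutely convergent power series in [y^2] differs from its constant term by at most
    [K y^2], whereas the value [y] varies linearly. The exponents [l k] may repeat, because
    different [j] produce the same power. *)
Lemma sqrt_not_power_series (l : nat -> nat) (c : nat -> R[i]) (x0 C : R) :
  0 < x0 -> (forall n, \sum_(k < n) normc (c k) * x0 ^+ l k <= C) ->
  ~ (forall y, 0 < y -> y ^+ 2 <= x0 -> forall e, 0 < e -> exists N, forall n,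
      (N <= n)%N -> normc (y%:C - \sum_(k < n) c k * (y ^+ 2)%:C ^+ l k) <= e).
Proof.
move=> x00 cC H.
have C0 : 0 <= C by have := cC 0%N; rewrite big_ord0.
pose K := C / x0; have K0 : 0 <= K by rewrite divr_ge0// ltW.
have dist y n : 0 < y -> y ^+ 2 <= x0 ->
   normc (\sum_(k < n) c k * (y ^+ 2)%:C ^+ l k - \sum_(k < n | l k == 0%N) c k) <= K * y ^+ 2.
  move=> y0 yx; have y20 : 0 < y ^+ 2 by rewrite exprn_gt0.
  (* A term of positive degree gains at least the factor [y^2 / x0] when the series passes from [x0]
     to [y^2]. *)
  have -> : K * y ^+ 2 = y ^+ 2 / x0 * C by rewrite /K; ring.
  apply: le_trans (ler_wpM2l _ (cC n)); last by rewrite divr_ge0// ltW.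
  rewrite [X in _ - X]big_mkcond /= -sumrB mulr_sumr.
  elim/big_ind2 : _ => [|a b a' b' ab ab'|k _].
  - by rewrite normc0.
  - exact: le_trans (ler_normcD _ _) (lerD ab ab').
  have [lk|lk] := eqVneq (l k) 0%N.
    rewrite lk expr0 mulr1 subrr normc0 mulr_ge0 ?divr_ge0 ?mulr_ge0 ?normc_ge0 ?ltW//.
  rewrite subr0 normcM normcX normc_real ger0_norm ?sqr_ge0//.
  case: (l k) lk => // m _; rewrite !(exprS _ m).
  have -> : y ^+ 2 / x0 * (normc (c k) * (x0 * x0 ^+ m)) =
     normc (c k) * (y ^+ 2 * x0 ^+ m) by field; rewrite gt_eqF.
  rewrite ler_wpM2l ?normc_ge0// ler_wpM2l ?(ltW y20)//.
  by rewrite lerXn2r ?nnegrE// ltW.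
(* With [8 K y <= 1] and tolerance [y / 16] the errors add up to [y / 8 + y / 8 + y / 32], which is
   below [y / 2]. *)
have [y [y0 yx yK]] : exists y : R, [/\ 0 < y, y ^+ 2 <= x0 & 8 * K * y <= 1].
  pose y := Num.min (Num.min 1 x0) (1 + 8 * K)^-1.
  have k8 : 0 < 1 + 8 * K by lra.
  have y0 : 0 < y by rewrite !lt_min ltr01 x00 invr_gt0.
  have ya : y <= 1 by rewrite /y !ge_min lexx.
  have yb : y <= x0 by rewrite /y !ge_min lexx orbT.
  have yc : y * (1 + 8 * K) <= 1.
    by rewrite -ler_pdivlMr// div1r /y ge_min lexx orbT.
  exists y; split=> //; first by rewrite expr2; nra.
  nra.
have y20 : 0 < y / 2 by rewrite divr_gt0.
have yx2 : (y / 2) ^+ 2 <= x0 by nra.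
have e0 : 0 < y / 16 by rewrite divr_gt0.
have [N1 H1] := H _ y0 yx _ e0; have [N2 H2] := H _ y20 yx2 _ e0.
pose n := maxn N1 N2.
have h := dist_halves (dist _ n y0 yx) (dist _ n y20 yx2)
  (H1 n (leq_maxl _ _)) (H2 n (leq_maxr _ _)).
have Ky : K * y ^+ 2 <= y / 8.
  have : 8 * K * y * y <= 1 * y by rewrite ler_wpM2r// ltW.
  by rewrite expr2; lra.
have Ky2 : K * (y / 2) ^+ 2 <= y / 32.
  by rewrite (_ : K * _ = K * y ^+ 2 / 4); [lra|field].
lra.
Qed.

End NonBasis.

(** * Norm growth of the monomials, probe points and failure of the expansion *)

Section ProbePoints.
Import Normc.
Local Open Scope complex_scope.
Context {R : realType}.
Local Notation mR := (measurableTypeR R).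
Local Notation R4 := ((mR * mR) * (mR * mR))%type.
Implicit Types (mu c nu : R) (z : C2 R) (f : C2 R -> C1 R).

Lemma cvg_carg_zeta mu z : truncated_worm mu z ->
  carg (worm_zeta w) @[w --> z] --> carg (worm_zeta z).
Proof.
move=> Dz; have z0 : z.2 != 0 by case: Dz.
have E w : carg (worm_zeta w) = complex.Im (worm_L w) - worm_angle w.
  by rewrite Im_worm_L addrK.
rewrite E; under eq_fun do rewrite E.
by apply: cvgB; [exact: cvg_Im (cvg_worm_L Dz)|exact: cvg_worm_angle].
Qed.

Lemma cvg_ln_z1 mu z : truncated_worm mu z ->
  ln (normc (w.1 : R[i])) @[w --> z] --> ln (normc (z.1 : R[i])).
Proof.
move=> Dz; rewrite -Re_worm_L; under eq_fun do rewrite -Re_worm_L.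
exact: cvg_Re (cvg_worm_L Dz).
Qed.

(** The sign [s] selects a point with [zeta = (1 + s i) / 2], of argument [s pi / 4]. On a box
    around it [s arg zeta > pi / 8], so for [s (j + 1) <= 0] the exponent term
    [- (j + 1) / 2 * arg zeta] is at least [pi / 16 * |j + 1|]; squaring doubles it. *)
Lemma worm_G_lower_sign mu (s : R) : 0 < mu -> s ^+ 2 = 1 -> exists a b,
  [/\ 0 < a, 0 < b & forall c (j : int), `|(j + 1)%:~R| = - (s * (j + 1)%:~R) ->
   ((a * expR (- (2 * b * `|c|) + pi / 8 * `|(j + 1)%:~R|))%:E
     <= worm_energy mu (worm_G c j))%E].
Proof.
move=> mu0 s1; pose z : C2 R := (2^-1 +i* (s / 2), 1).
have t0 : worm_angle z = 0 by rewrite /worm_angle normc1 expr1n ln1.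
have Z : worm_zeta z = 2^-1 +i* (s / 2).
  rewrite /worm_zeta t0 (_ : cexp _ = 1) ?mulr1// -cexp0.
  by congr cexp; rewrite oppr0.
have Dz : truncated_worm mu z.
  split; first exact: oner_neq0.
    rewrite t0 (_ : cexp _ = 1); last by rewrite -cexp0.
    by rewrite sqr_normcE /=; nra.
  by rewrite t0 normr0.
have az : carg (worm_zeta z) = s * (pi / 4).
  rewrite Z carg_atan /=; last by rewrite invr_gt0.
  have -> : s / 2 / 2^-1 = s by field.
  have : (s - 1) * (s + 1) == 0 by rewrite -subr_sqr s1 expr1n subrr.
  rewrite mulf_eq0 => /orP[|]; rewrite ?subr_eq0 ?addr_eq0 => /eqP ->.
    by rewrite atan1 mul1r.
  by rewrite atanN atan1 mulN1r.
pose b := `|ln (normc (z.1 : R[i]))| + 1; have b0 : 0 < b by rewrite ltr_wpDl.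
have n1 : \forall w \near z, `|ln (normc (w.1 : R[i]))| < b.
  by apply: cvgr_lt _ (cvg_norm (cvg_ln_z1 Dz)) _ _; rewrite ltrDl.
have n2 : \forall w \near z, pi / 8 < s * carg (worm_zeta w).
  have H : s * carg (worm_zeta w) @[w --> z] --> s * carg (worm_zeta z).
    by apply: cvgM; [exact: cvg_cst|exact: cvg_carg_zeta Dz].
  apply: cvgr_gt _ H _ _; rewrite az mulrA -expr2 s1 mul1r.
  by have := pi_gt0 R; lra.
have [p [d [d0 sub]]] := near_box (filterI (near_worm Dz) (filterI n1 n2)).
(* Volume of the box times the square of the lower bound [exp (- mu / 2)] for the worm angle
   factor. *)
exists (16 * d ^+ 4 * expR (- mu)), b; split=> // [|c j sj].
  by rewrite mulr_gt0 ?expR_gt0// mulr_gt0// exprn_gt0.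
have cG : worm_continuous mu (worm_G c j).
  by apply: holomorphic_continuous => w Dw; exact: differentiable_worm_G Dw.
pose k := expR (- (b * `|c|) + pi / 16 * `|(j + 1)%:~R| - mu / 2).
apply: le_trans (@worm_energy_ge_box _ mu _ p d k (ltW d0) (expR_ge0 _) cG _) => [|q].
  rewrite lee_fin -mulrA -expRD [k ^+ 2]expr2 -expRD mulrC.
  rewrite ler_wpM2r// ?mulr_ge0 ?exprn_ge0 ?(ltW d0)// ler_expR; lra.
move=> /sub[Dq [q1 q2]]; split=> //; rewrite (normc_worm_G _ _ Dq) ler_expR.
have h1 : - (b * `|c|) <= c * ln (normc ((to_C2 q).1 : R[i])).
  have : `|c * ln (normc ((to_C2 q).1 : R[i]))| <= b * `|c|.
    by rewrite normrM mulrC ler_wpM2r// ltW.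
  by rewrite ler_norml => /andP[].
have h2 : pi / 16 * `|(j + 1)%:~R| <= - ((j + 1)%:~R / 2 * carg (worm_zeta (to_C2 q))).
  have -> : - ((j + 1)%:~R / 2 * carg (worm_zeta (to_C2 q))) =
     (- (s * (j + 1)%:~R)) / 2 * (s * carg (worm_zeta (to_C2 q))).
    rewrite [RHS](_ : _ = s ^+ 2 * (- ((j + 1)%:~R / 2 * carg (worm_zeta (to_C2 q))))).
      by rewrite s1 mul1r.
    by ring.
  rewrite -sj [leRHS]mulrAC.
  have : pi / 8 * `|(j + 1)%:~R| <= s * carg (worm_zeta (to_C2 q)) * `|(j + 1)%:~R|.
    by rewrite ler_wpM2r// ltW.
  lra.
have h3 : worm_angle (to_C2 q) <= mu.
  by case: Dq => _ _ /ltW; apply: le_trans (ler_norm _).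
lra.
Qed.

Lemma worm_G_lower mu : 0 < mu -> exists a b,
  [/\ 0 < a, 0 < b & forall c (j : int),
   ((a * expR (- (2 * b * `|c|) + pi / 8 * `|(j + 1)%:~R|))%:E
     <= worm_energy mu (worm_G c j))%E].
Proof.
move=> mu0.
have [a1 [b1 [a10 b10 H1]]] := worm_G_lower_sign mu0 (expr1n R 2).
have [a2 [b2 [a20 b20 H2]]] := worm_G_lower_sign mu0 (etrans (sqrrN 1) (expr1n R 2)).
exists (Num.min a1 a2), (Num.max b1 b2); split=> [||c j].
- by rewrite lt_min a10.
- by rewrite lt_max b10.
have mono a b : Num.min a1 a2 <= a -> b <= Num.max b1 b2 ->
  Num.min a1 a2 * expR (- (2 * Num.max b1 b2 * `|c|) + pi / 8 * `|(j + 1)%:~R|)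
  <= a * expR (- (2 * b * `|c|) + pi / 8 * `|(j + 1)%:~R|) :> R.
  move=> am bm; rewrite ler_pM ?expR_ge0//.
    by rewrite le_min !ltW.
  rewrite ler_expR lerD2r lerN2 ler_wpM2r//; lra.
have [j0|j0] := leP 0 ((j + 1)%:~R : R).
  apply: le_trans (H2 c j _); last by rewrite ger0_norm// mulN1r opprK.
  by rewrite lee_fin mono// ?ge_min ?le_max lexx orbT.
apply: le_trans (H1 c j _); last by rewrite ltr0_norm// mul1r.
by rewrite lee_fin mono// ?ge_min ?le_max lexx.
Qed.

Definition probe (r : R) : C2 R := (r%:C, cexp (0 -i* (ln r / 2))).

Lemma probe_angle r : worm_angle (probe r) = 0.
Proof. by rewrite /worm_angle normc_cexp_i expr1n ln1. Qed.

Lemma probe_zeta r : worm_zeta (probe r) = r%:C.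
Proof.
rewrite /worm_zeta probe_angle (_ : cexp _ = 1) ?mulr1// -cexp0.
by congr cexp; rewrite oppr0.
Qed.

Lemma probe_in mu r : 0 < mu -> 0 < r < 2 -> truncated_worm mu (probe r).
Proof.
move=> mu0 /andP[r0 r2]; split; first exact: cexp_neq0.
  rewrite probe_angle (_ : cexp _ = 1); last by rewrite -cexp0.
  by rewrite sqr_normcE /=; nra.
by rewrite probe_angle normr0.
Qed.

Lemma probe_arg r : 0 < r -> carg (worm_zeta (probe r)) = 0.
Proof. by move=> r0; rewrite probe_zeta carg_atan //= mul0r atan0. Qed.

Lemma cexp_i_int (t : R) (j : int) : cexp (0 +i* t) ^ j = cexp (0 +i* (j%:~R * t)).
Proof.
have E n : cexp (0 +i* t) ^+ n = cexp (0 +i* (n%:R * t)).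
  elim: n => [|n IH]; first by rewrite expr0 mul0r -cexp0.
  rewrite exprS IH -cexpD; congr cexp; apply/eqP; rewrite eq_complex /=.
  by rewrite addr0 eqxx -natr1 mulrDl mul1r addrC eqxx.
case: j => n; first exact: E.
rewrite NegzE -exprnN E -cexpN; congr cexp; apply/eqP; rewrite eq_complex /=.
by rewrite oppr0 mulrNz mulNr !eqxx.
Qed.

(** At the probe [L = ln r] is real; the phases [(j + 1) / 2 * ln r] of the exponential and
    [- j / 2 * ln r] of [z2 ^ j] leave [ln r / 2] for every [j]. *)
Lemma probe_G c (j : int) r : 0 < r ->
  worm_G c j (probe r) = (expR (c * ln r))%:C * cexp (0 +i* (ln r / 2)).
Proof.
move=> r0; have L : worm_L (probe r) = (ln r)%:C.
  apply/eqP; rewrite eq_complex Re_worm_L Im_worm_L probe_arg// probe_angle.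
  by rewrite normc_real gtr0_norm// /= addr0 !eqxx.
rewrite /worm_G /worm_E L cexp_i_int -cexp_real -!cexpD; congr cexp.
apply/eqP; rewrite eq_complex /= intrD; apply/andP; split; apply/eqP; by field.
Qed.

Lemma worm_energyZ mu f (k : R[i]) : worm_continuous mu f ->
  worm_energy mu (k *: f) = ((normc k ^+ 2)%:E * worm_energy mu f)%E.
Proof.
move=> cf; rewrite /worm_energy -ge0_integralZl//.
- by apply: eq_integral => p _; rewrite -EFinM -exprMn -normcM.
- exact: measurable_worm.
- exact: measurable_energy.
- by move=> p _; rewrite lee_fin sqr_ge0.
- by rewrite lee_fin sqr_ge0.
Qed.

Lemma worm_G_not_basis mu c0 nu (e : nat -> nat * int) :
  0 < mu -> 0 < nu -> -1 < c0 -> injective e ->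
  ~ schauder_basis (bergman (truncated_worm mu)) (L2norm (truncated_worm mu))
      (fun n => worm_G (c0 + nu * (e n).1%:R) (e n).2 : C2 R -> C1 R).
Proof.
move=> mu0 nu0 c01 eI [bv basis].
pose v n := worm_G (c0 + nu * (e n).1%:R) (e n).2 : C2 R -> C1 R.
pose f := worm_G (c0 + nu / 2) 0 : C2 R -> C1 R.
have bf : bergman (truncated_worm mu) f.
  by apply: bergman_worm_G; rewrite (lt_le_trans c01)// lerDl divr_ge0// ltW.
have [c [cvgc _]] := basis f bf.
pose F n := \sum_(k < n) c k *: v k.
have bF n : bergman (truncated_worm mu) (F n).
  by apply: bergman_sum => i; apply: bergmanZ; exact: bv.
have cf := holomorphic_continuous bf.1.
have cF n := holomorphic_continuous (bF n).1.
have bfF n : bergman (truncated_worm mu) (f - F n).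
  by rewrite -[- F n]scaleN1r; apply: bergmanD; [exact: bf|exact: bergmanZ].
have cfF n := holomorphic_continuous (bfF n).1.
have L2 t : 0 < t -> exists N, forall n, (N <= n)%N ->
    (worm_energy mu (f - F n)%R < t%:E)%E.
  move=> t0; have s0 : 0 < Num.sqrt t by rewrite sqrtr_gt0.
  have /fine_cvgP[[N1 _ H1] /cvgrPdist_lt/(_ _ s0)[N2 _ H2]] := cvgc.
  exists (maxn N1 N2) => n; rewrite geq_max => /andP[n1 n2].
  rewrite -(sqr_sqrtr (ltW t0)) -L2norm_lt//.
  have fin := H1 n n1; rewrite -(fineK fin) lte_fin.
  apply: le_lt_trans (ler_norm _) _.
  by have := H2 n n2; rewrite /= sub0r normrN.
have [a [b [a0 b0 low]]] := worm_G_lower mu0.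
pose J k : R := `|((e k).2 + 1)%:~R|.
pose wt k := a * expR (- (2 * b * (`|c0| + nu * (e k).1%:R)) + pi / 8 * J k).
have wt0 k : 0 < wt k by rewrite mulr_gt0// expR_gt0.
have cv k : worm_continuous mu (v k) := holomorphic_continuous (bv k).1.
have lowv k : ((normc (c k) ^+ 2 * wt k)%:E <= worm_energy mu (c k *: v k)%R)%E.
  rewrite (worm_energyZ (c k) (cv k)) EFinM; apply: lee_wpmul2l.
    by rewrite lee_fin sqr_ge0.
  apply: le_trans (low _ _); rewrite lee_fin ler_pM2l// ler_expR lerD2r lerN2.
  rewrite ler_pM2l ?mulr_gt0//; apply: (le_trans (ler_normD _ _)).
  by rewrite lerD2l ger0_norm// mulr_ge0// ltW.
(* For [k >= N] the term is a difference of two remainders of energy below 1, so [worm_energyD]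
   bounds its energy by 4; the finite sum covers the indices below [N]. *)
have [M2 [M20 cM]] : exists M2, 0 < M2 /\ forall k, normc (c k) ^+ 2 * wt k <= M2.
  have [N HN] := L2 _ ltr01.
  have p0 k : 0 <= normc (c k) ^+ 2 * wt k by rewrite mulr_ge0 ?sqr_ge0 ?ltW.
  have S0 : 0 <= \sum_(k < N) normc (c k) ^+ 2 * wt k by rewrite sumr_ge0.
  exists (4 + \sum_(k < N) normc (c k) ^+ 2 * wt k); split; first lra.
  move=> k; have [kN|Nk] := ltnP k N.
    rewrite (bigD1 (Ordinal kN))//= addrCA lerDl addr_ge0// sumr_ge0//.
  apply: (@le_trans _ _ 4); last by rewrite lerDl.
  rewrite -lee_fin; apply: le_trans (lowv k) _.
  have -> : c k *: v k = (f - F k) + (-1) *: (f - F k.+1).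
    rewrite /F big_ord_recr /= scaleN1r opprB [RHS]addrC addrA subrK.
    by rewrite addrAC subrr add0r.
  apply: le_trans (worm_energyD (cfF k) (holomorphic_continuous (bergmanZ (-1) (bfF k.+1)).1)) _.
  rewrite (worm_energyZ (-1) (cfF k.+1)) normc_opp normc1 expr1n mul1e.
  have -> : (4%:E = 2%:E * 1%:E + 2%:E * 1%:E :> \bar R)%E.
    by rewrite !mule1 -EFinD; congr (_%:E); lra.
  by rewrite leeD// lee_wpmul2l ?lee_fin// ltW// HN// leqW.
pose jj k := absz ((e k).2 + 1)%R.
have JE k : J k = (jj k)%:R by rewrite /J /jj natr_absz intr_norm.
pose M1 := Num.sqrt (M2 / a) * expR (b * `|c0|).
have M10 : 0 < M1 by rewrite mulr_gt0 ?expR_gt0// sqrtr_gt0 divr_gt0.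
(* Taking the square root of [cM] halves the exponents in [wt]. *)
have cB k : normc (c k) <= M1 * expR (nu * b * (e k).1%:R - pi / 16 * J k).
  rewrite -(@ler_pXn2r _ 2) ?nnegrE ?normc_ge0 ?mulr_ge0 ?expR_ge0 ?sqrtr_ge0//.
  rewrite /M1 !exprMn sqr_sqrtr; last by rewrite divr_ge0 ?ltW.
  have := cM k; rewrite -ler_pdivlMr// => /le_trans; apply.
  have -> : M2 / wt k =
      M2 / a * expR (2 * b * (`|c0| + nu * (e k).1%:R) - pi / 8 * J k).
    by rewrite /wt invfM mulrA -expRN opprD opprK.
  rewrite -[expR _ ^+ 2](expRM_natl 2) -[expR _ ^+ 2](expRM_natl 2).
  by rewrite -[leRHS]mulrA -expRD ler_pM2l ?divr_gt0// ler_expR; lra.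
(* The decay rate [pi / 16] of the coefficients in [J] is split: half absorbs the growth of the
   monomials where [|arg zeta| < pi / 16], and half remains in [y] for summation. *)
pose x : R := expR (-1); pose y : R := expR (- (pi / 32)).
have pp := pi_gt0 R.
have x1 : 0 <= x < 1 by rewrite expR_ge0 expR_lt1 oppr_lt0 ltr01.
have y1 : 0 <= y < 1 by rewrite expR_ge0 expR_lt1 oppr_lt0 divr_gt0.
pose A k := x ^+ (e k).1 * y ^+ jj k.
have A0 k : 0 <= A k by rewrite mulr_ge0// exprn_ge0 ?expR_ge0.
have AE k : A k = expR (- (e k).1%:R - pi / 32 * J k).
  by rewrite /A /x /y -(expRM_natl (e k).1) -(expRM_natl (jj k)) -expRD JE; congr expR; ring.
have [S AS] := geometric_sum_inj eI x1 y1.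
(* One unit beyond [nu b] gives the ratio [x = exp (-1)]; the second makes [nu ln r < - (nu b + 1)]
   strict, hence stable near the probe. *)
pose x0 := expR (- (nu * b + 2)).
have J0 k : 0 <= J k by exact: normr_ge0.
apply: (@sqrt_not_power_series _ (fun k => (e k).1) c x0 (M1 * S)).
- exact: expR_gt0.
- move=> n; apply: le_trans (ler_wpM2l (ltW M10) (AS n)).
  rewrite mulr_sumr; apply: ler_sum => k _; rewrite -[X in _ <= _ * X]/(A k) AE.
  rewrite /x0 -(expRM_natl (e k).1).
  apply: (le_trans (ler_wpM2r (expR_ge0 _) (cB k))).
  rewrite -[leLHS]mulrA -expRD ler_pM2l// ler_expR.
  have : 0 <= (e k).1%:R :> R by [].
  have := J0 k; have := mulr_ge0 (ltW pp) (J0 k); lra.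
move=> q q0 qx t t0.
(* Chosen so that [r^nu = q^2]. *)
pose r := expR (2 * ln q / nu).
have r0 : 0 < r := expR_gt0 _.
have lnr : ln r = 2 * ln q / nu by rewrite /r expRK.
have nlr : nu * ln r = 2 * ln q by rewrite lnr; field; rewrite gt_eqF.
have nlr2 : nu * ln r < - (nu * b + 1).
  rewrite nlr; have : expR (2 * ln q) <= x0.
    by rewrite mulrC expRM_natr lnK// posrE.
  rewrite ler_expR; lra.
have r1 : r < 1.
  rewrite /r expR_lt1 -lnr -(pmulr_rlt0 _ nu0).
  by have := mulr_gt0 nu0 b0; lra.
have Dr : truncated_worm mu (probe r) by apply: probe_in; rewrite ?r0//=; lra.
have C1 : 0 < expR (c0 * ln r) := expR_gt0 _.
(* The tolerance is scaled by [r^c0], the modulus of the common factor divided out at the end. *)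
have tt0 : 0 < t * expR (c0 * ln r) by rewrite mulr_gt0.
have uc s : 0 < s -> exists N, \forall y \near probe r, forall n, (N <= n)%N ->
     normc (F n y - F N y) <= s.
  move=> s0; pose K := M1 * expR (c0 * ln r + 1 + mu / 2).
  have K0 : 0 < K by rewrite mulr_gt0 ?expR_gt0.
  have [N HN] := bounded_sum_cauchy A0 AS (divr_gt0 s0 K0).
  exists N.
  have lnn : ln (normc ((probe r).1 : R[i])) = ln r by rewrite normc_real gtr0_norm.
  have n1 : \forall w \near probe r, nu * ln (normc (w.1 : R[i])) < - (nu * b + 1).
    have H : nu * ln (normc (w.1 : R[i])) @[w --> probe r] --> nu * ln r.
      by apply: cvgM; [exact: cvg_cst|rewrite -lnn; exact: cvg_ln_z1 Dr].
    exact: cvgr_lt _ H _ nlr2.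
  have n2 : \forall w \near probe r, c0 * ln (normc (w.1 : R[i])) < c0 * ln r + 1.
    have H : c0 * ln (normc (w.1 : R[i])) @[w --> probe r] --> c0 * ln r.
      by apply: cvgM; [exact: cvg_cst|rewrite -lnn; exact: cvg_ln_z1 Dr].
    have lt1 : c0 * ln r < c0 * ln r + 1 by rewrite ltrDl.
    exact: cvgr_lt _ H _ lt1.
  have n3 : \forall w \near probe r, `|carg (worm_zeta w)| < pi / 16.
    have p16 : `|carg (worm_zeta (probe r))| < pi / 16.
      by rewrite probe_arg// normr0 divr_gt0.
    exact: cvgr_lt _ (cvg_norm (cvg_carg_zeta Dr)) _ p16.
  near=> w => n Nn.
  have Dw : truncated_worm mu w by near: w; exact: near_worm.
  have w1 : nu * ln (normc (w.1 : R[i])) < - (nu * b + 1) by near: w.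
  have w2 : c0 * ln (normc (w.1 : R[i])) < c0 * ln r + 1 by near: w.
  have w3 : `|carg (worm_zeta w)| < pi / 16 by near: w.
  (* The growth [exp (nu b l)] of the coefficients is beaten by
     [|z1|^(nu l) <= exp (- (nu b + 1) l)], which leaves [exp (- l)]. *)
  have term k : normc (c k * v k w) <= K * A k.
    rewrite normcM (normc_worm_G _ _ Dw) AE /K -[leRHS]mulrA -expRD.
    apply: (le_trans (ler_wpM2r (expR_ge0 _) (cB k))).
    rewrite -[leLHS]mulrA -expRD ler_pM2l// ler_expR.
    have h1 : - (((e k).2 + 1)%:~R / 2 * carg (worm_zeta w)) <= pi / 32 * J k.
      apply: le_trans (ler_norm _) _; rewrite normrN !normrM -/(J k).
      rewrite [`|2^-1|]ger0_norm// -mulrA mulrC.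
      have : `|carg (worm_zeta w)| * J k <= pi / 16 * J k by rewrite ler_wpM2r// ltW.
      lra.
    have h2 : - (worm_angle w / 2) <= mu / 2.
      by case: Dw => _ _; rewrite ltr_norml => /andP[]; lra.
    have h3 : nu * ln (normc (w.1 : R[i])) * (e k).1%:R <= - (nu * b + 1) * (e k).1%:R.
      by rewrite ler_wpM2r// ltW.
    lra.
  have -> : F n w - F N w = \sum_(N <= k < n) c k * v k w.
    have FE m : F m w = \sum_(0 <= k < m) c k * v k w.
      by rewrite /F fct_sumE big_mkord.
    by rewrite !FE (big_cat_nat (leq0n N) Nn) //= addrAC subrr add0r.
  have -> : s = K * (s / K) by field; rewrite gt_eqF.
  apply: le_trans (ler_wpM2l (ltW K0) (HN n Nn)); rewrite mulr_sumr.
  elim/big_ind2 : _ => [|z1 z2 z3 z4 h1 h2|k _]; [by rewrite normc0| |exact: term].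
  exact: le_trans (ler_normcD _ _) (lerD h1 h2).
have [N HN] := L2_cvg_pointwise cf cF L2 Dr uc tt0.
exists N => n Nn; have := HN n Nn.
(* Once the common factor is split off, [f] contributes [q = r^(nu / 2)] and the partial sum a
   polynomial in [q^2]. *)
have -> : f (probe r) - F n (probe r) =
   (expR (c0 * ln r))%:C * cexp (0 +i* (ln r / 2)) *
   (q%:C - \sum_(k < n) c k * (q ^+ 2)%:C ^+ (e k).1).
  rewrite mulrBr /f probe_G//; congr (_ - _).
    have lq : nu / 2 * ln r = ln q by rewrite mulrAC nlr; field.
    by rewrite mulrDl lq expRD lnK ?posrE// rmorphM; ring.
  rewrite /F fct_sumE mulr_sumr; apply: eq_bigr => k _.
  rewrite -[(_ *: _) _]/(c k * v k (probe r)) /v probe_G//.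
  rewrite mulrDl expRD rmorphM /=.
  have -> : (expR (nu * (e k).1%:R * ln r))%:C = (q ^+ 2)%:C ^+ (e k).1.
    rewrite -rmorphXn /= [nu * _ * _]mulrAC nlr expRM_natr; congr (_ ^+ _)%:C.
    by rewrite mulrC expRM_natr lnK.
  by ring.
rewrite !normcM normc_cexp_i mulr1 normc_real gtr0_norm// mulrC.
by rewrite ler_pM2r.
Unshelve. all: by end_near. Qed.

End ProbePoints.

Theorem theorem3p3 (R : realType) (mu c0 nu : R)
    (hmu : pi / 2 <= mu) (hc0 : -1 < c0) (hnu : nu = pi / (2 * mu)) :
  let D := truncated_worm mu in
  let A2 := bergman D in
  let H := worm_H c0 nu in
  [/\ (forall (l : nat) (j : int), A2 (H l j)),
      (forall j : int,
         norm_closure A2 (L2norm D)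
           (linspan [set H l j | l in [set l : nat | (1 <= l)%N]]) (H 0%N j)) &
      (forall e : nat -> nat * int, bijective e ->
         ~ schauder_basis A2 (L2norm D) (fun n => H (e n).1 (e n).2))].
Proof.
move=> D A2 H; have pp := pi_gt0 R; have mu0 : 0 < mu by lra.
have nu0 : 0 < nu by rewrite hnu divr_gt0// mulr_gt0.
split=> [l j|j|e /bij_inj]; last exact: worm_G_not_basis.
  by apply: bergman_worm_G; rewrite (lt_le_trans hc0)// lerDl mulr_ge0// ltW.
have -> : H 0%N j = worm_G c0 j by rewrite /H worm_HE mulr0 addr0.
exact: worm_G_closure.
Qed.
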